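(* Let $\omega\in\Omega$ with $\beta_1<1$, $E=E^\omega$, let $N\ge1$, $a\in\{\pm\frac12\}$, and let $(n_1,a_1)$ be a level with $2n_1+a_1\le2N+a$. Then for $1\le l\le n_1$, \[\Psi^{n_1,a_1}_{n_1-l}(s)=\frac{W^{(a_1,-1/2)}(s)}{\pi}\int_{-1}^1E(x)\mathsf{J}^{(a_1,-1/2)}_s(x)(x-1)^{n_1-l}(1-x)^{a_1}(1+x)^{-1/2}dx,\] and for $n_1<l\le N$, \[\Psi^{n_1,a_1}_{n_1-l}(s)=\frac{W^{(a_1,-1/2)}(s)}{\pi}\int_{-1}^1\frac{E(x)-\sum_{j=0}^{l-n_1-1}\frac{E^{(j)}(1)}{j!}(x-1)^j}{(x-1)^{l-n_1}}\,\mathsf{J}^{(a_1,-1/2)}_s(x)(1-x)^{a_1}(1+x)^{-1/2}dx .\]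
   Context: $\mathsf{J}^{(-1/2,-1/2)}_s(\cos\theta)=\cos s\theta$, $\mathsf{J}^{(1/2,-1/2)}_s(\cos\theta)=\sin((s+\frac12)\theta)/\sin(\theta/2)$; $W^{(-1/2,-1/2)}(0)=1$, $W^{(-1/2,-1/2)}(s)=2$ ($s>0$), $W^{(1/2,-1/2)}\equiv1$. $\Omega$: triples $(\alpha,\beta,\delta)$, $\alpha_1\ge\alpha_2\ge\dots\ge0$, $\beta_1\ge\beta_2\ge\dots\ge0$, $\sum(\alpha_i+\beta_i)\le\delta$, $\gamma=\delta-\sum(\alpha_i+\beta_i)$, $E^\omega(x)=e^{\gamma(x-1)}\prod_i\frac{1-\beta_i(1-x)+\beta_i^2(1-x)/2}{1+\alpha_i(1-x)+\alpha_i^2(1-x)/2}$. Levels $(n,b)$, $n\ge1$, $b\in\{\pm\frac12\}$, ordered by $2n+b$. Matrices on $\mathbb{Z}_{\ge0}\times\mathbb{Z}_{\ge0}$: $\mathcal{T}(x,y)=0$ if $x<y$, $1$ if $x\ge y=0$, $2$ if $x\ge y>0$; $\phi(x,y)=\mathbf 1[x>y]$; product $(f*g)(x,y)=\sum_{z\ge0}f(x,z)g(z,y)$. For $2n_1+b_1<2n_2+b_2$: $\phi^{(n_1,b_1),(n_2,b_2)}=(\mathcal{T}*\phi)^{n_2-n_1}*\mathcal{T}$ if $(b_1,b_2)=(-\frac12,\frac12)$; $(\mathcal{T}*\phi)^{n_2-n_1}$ if $(\frac12,\frac12)$; $(\phi*\mathcal{T})^{n_2-n_1-1}*\phi$ if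 $(\frac12,-\frac12)$; $(\phi*\mathcal{T})^{n_2-n_1}$ if $(-\frac12,-\frac12)$. Functions: $\Psi^{N,a}_{N-l}(s)=\frac{W^{(a,-1/2)}(s)}\pi\int_{-1}^1E(x)\mathsf{J}^{(a,-1/2)}_s(x)(x-1)^{N-l}(1-x)^a(1+x)^{-1/2}dx$ for $1\le l\le N$, $s\ge0$; for a level $(n,b)$ with $2n+b<2N+a$ and $1\le l\le N$, $\Psi^{n,b}_{n-l}(s)=\sum_{z\ge0}\Psi^{N,a}_{N-l}(z)\,\phi^{(n,b),(N,a)}(z,s)$; for $(n,b)=(N,a)$ it is $\Psi^{N,a}_{N-l}$ itself. *)

(* Defs.v *)
From Stdlib Require Import Reals Factorial.
From Coquelicot Require Import Coquelicot.
Open Scope R_scope.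

(* A half-integer parameter b in {+1/2, -1/2} is encoded by a bool:
   true <-> +1/2, false <-> -1/2. *)
Definition hv (b : bool) : R := if b then 1/2 else -1/2.

Definition Jac (b : bool) (s : nat) (x : R) : R :=
  if b then sin ((INR s + 1/2) * acos x) / sin (acos x / 2)
  else cos (INR s * acos x).

Definition Wt (b : bool) (s : nat) : R :=
  if b then 1 else match s with O => 1 | S _ => 2 end.

(* The parameter set Omega (sequences indexed from 0: alpha 0 = alpha_1). *)
Definition in_Omega (alpha beta : nat -> R) (delta : R) : Prop :=
  (forall i, 0 <= alpha i) /\ (forall i, alpha (S i) <= alpha i) /\
  (forall i, 0 <= beta i) /\ (forall i, beta (S i) <= beta i) /\
  ex_series (fun i => alpha i + beta i) /\
  Series (fun i => alpha i + beta i) <= delta.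

Definition gammaO (alpha beta : nat -> R) (delta : R) : R :=
  delta - Series (fun i => alpha i + beta i).

Definition Efactor (alpha beta : nat -> R) (i : nat) (x : R) : R :=
  (1 - beta i * (1 - x) + (beta i)^2 * (1 - x) / 2) /
  (1 + alpha i * (1 - x) + (alpha i)^2 * (1 - x) / 2).

Fixpoint Epartial (alpha beta : nat -> R) (n : nat) (x : R) : R :=
  match n with
  | O => 1
  | S k => Epartial alpha beta k x * Efactor alpha beta k x
  end.

Definition Eom (alpha beta : nat -> R) (delta : R) (x : R) : R :=
  exp (gammaO alpha beta delta * (x - 1)) *
  real (Lim_seq (fun n => Epartial alpha beta n x)).

(* Matrices on Z>=0 x Z>=0.  All matrices below are lower triangular
   (f x z = 0 for z > x), so the product sum over z >= 0 reduces to z <= x. *)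
Definition Tm (x y : nat) : R :=
  if Nat.ltb x y then 0 else match y with O => 1 | S _ => 2 end.
Definition phim (x y : nat) : R := if Nat.ltb y x then 1 else 0.
Definition idm (x y : nat) : R := if Nat.eqb x y then 1 else 0.
Definition mprod (f g : nat -> nat -> R) (x y : nat) : R :=
  sum_f_R0 (fun z => f x z * g z y) x.
Fixpoint mpow (f : nat -> nat -> R) (k : nat) : nat -> nat -> R :=
  match k with O => idm | S k' => mprod (mpow f k') f end.

(* phi^{(n1,b1),(n2,b2)} for 2 n1 + b1 < 2 n2 + b2 *)
Definition phiL (n1 : nat) (b1 : bool) (n2 : nat) (b2 : bool) : nat -> nat -> R :=
  match b1, b2 with
  | false, true => mprod (mpow (mprod Tm phim) (n2 - n1)) Tm
  | true, true => mpow (mprod Tm phim) (n2 - n1)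
  | true, false => mprod (mpow (mprod phim Tm) (n2 - n1 - 1)) phim
  | false, false => mpow (mprod phim Tm) (n2 - n1)
  end.

Definition PsiTop (alpha beta : nat -> R) (delta : R) (N : nat) (a : bool)
    (l s : nat) : R :=
  Wt a s / PI *
  RInt_gen (fun x => Eom alpha beta delta x * Jac a s x * (x - 1) ^ (N - l) *
                     Rpower (1 - x) (hv a) * Rpower (1 + x) (-1/2))
           (at_right (-1)) (at_left 1).

(* "Psi^{n,b}_{n-l}(s) = v" for a level (n,b) with 2n+b <= 2N+a (top level (N,a)).
   Below the top level, Psi is a series over z >= 0; the assertion includes
   its convergence to v. *)
Definition PsiIs (alpha beta : nat -> R) (delta : R) (N : nat) (a : bool)
    (n : nat) (b : bool) (l s : nat) (v : R) : Prop :=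
  if andb (Nat.eqb n N) (Bool.eqb b a) then PsiTop alpha beta delta N a l s = v
  else is_series (fun z => PsiTop alpha beta delta N a l z * phiL n b N a z s) v.

(* Main.v *)
Require Import Defs.
From Stdlib Require Import Reals Factorial.
From Coquelicot Require Import Coquelicot.
From Stdlib Require Import Lra Lia FunctionalExtensionality.
Open Scope R_scope.

(* Every factor of [E] is a quotient [(1 - b + b x) / (1 + a - a x)], so [E] is the sum of a
   power series at [0] of radius larger than [1].  For such a function [F x], the substitution
   [x = cos t] turns the integrals into cosine coefficients [c s] of [F], which decay
   geometrically: the level function of [F] is [W s * c s] for the parameter [-1/2] and
   [c s - c (S s)] for [1/2].  Summation against [Tm] telescopes and keeps [F]; summation
   against [phim] telescopes as well and replaces [F] by [(F x - F 1) / (x - 1)], because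
   [(cos t - 1) * G] has a second difference of the coefficients of [G] as coefficients, and
   constants have none at [s > 0].  Starting from [E x * (x - 1) ^ (N - l)], the first [N - l]
   divisions remove the powers of [x - 1], and the further ones produce Taylor remainders
   of [E] at [1]. *)

(** * Power series with geometrically decaying coefficients *)

(** Working with coefficients at [0] makes division by [x - 1] the total operation [divX1], a
    sequence of tail sums, so the removable singularity at [x = 1] never appears and the decay rate
    is kept. A radius strictly larger than [1] serves twice: the Taylor coefficients are derivatives
    at [1] and need a neighbourhood of that point, and geometric decay pays for regrouping the
    double series over matrix products, whose entries grow with the row index. The radius is uniform
    in the infinite product because the factor with parameter [a] has its pole at [1 + 1 / a] and
    these parameters are bounded; convergence of the coefficients comes from summability of the
    parameters. *)

Definition geo_bound (C r : R) (u : nat -> R) : Prop :=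
  forall n, Rabs (u n) <= C * r ^ n.

Definition geometric (u : nat -> R) : Prop :=
  exists C r, 0 < r < 1 /\ geo_bound C r u.

Lemma geo_bound_pos (C r : R) (u : nat -> R) : geo_bound C r u -> 0 <= C.
Proof.
  intros H. specialize (H 0%nat). pose proof (Rabs_pos (u 0%nat)).
  simpl in H. lra.
Qed.

Lemma is_series_scal_geom (C q : R) :
  Rabs q < 1 -> is_series (fun n => C * q ^ n) (C / (1 - q)).
Proof.
  intros Hq. apply (is_series_scal C (fun n => q ^ n)).
  now apply is_series_geom.
Qed.

Lemma geom_dominated_series (C q : R) (u : nat -> R) :
  0 <= q < 1 -> geo_bound C q u ->
  ex_series u /\ Rabs (Series u) <= C / (1 - q).
Proof.
  intros Hq Hu.
  assert (Hs : is_series (fun n => C * q ^ n) (C / (1 - q))).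
  { apply is_series_scal_geom. rewrite Rabs_pos_eq; lra. }
  assert (Ha : ex_series (fun n => Rabs (u n))).
  { apply (@ex_series_le R_AbsRing R_CompleteNormedModule) with (fun n => C * q ^ n).
    - intros n. unfold norm; simpl. unfold abs; simpl. rewrite Rabs_Rabsolu. apply Hu.
    - eexists; exact Hs. }
  split.
  - now apply ex_series_Rabs.
  - eapply Rle_trans; [now apply Series_Rabs|].
    rewrite <- (is_series_unique _ _ Hs). apply Series_le.
    + intros n. split; [apply Rabs_pos | apply Hu].
    + eexists; exact Hs.
Qed.

Lemma geo_bound_eval (C r x : R) (u : nat -> R) :
  0 < r -> geo_bound C r u -> geo_bound C (r * Rabs x) (fun n => u n * x ^ n).
Proof.
  intros Hr Hu n. rewrite Rabs_mult, <- RPow_abs, Rpow_mult_distr, <- Rmult_assoc.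
  apply Rmult_le_compat_r; [apply pow_le, Rabs_pos | apply Hu].
Qed.

Lemma geo_bound_pseries (C r x : R) (u : nat -> R) :
  0 < r -> r * Rabs x < 1 -> geo_bound C r u ->
  ex_pseries u x /\ Rabs (PSeries u x) <= C / (1 - r * Rabs x).
Proof.
  intros Hr Hx Hu.
  destruct (geom_dominated_series C (r * Rabs x) (fun n => u n * x ^ n)) as [H1 H2].
  - split; [|exact Hx]. apply Rmult_le_pos; [lra|apply Rabs_pos].
  - now apply geo_bound_eval.
  - split; [|exact H2]. now apply ex_pseries_R.
Qed.

Lemma geo_bound_CV_radius (C r : R) (u : nat -> R) :
  0 < r -> geo_bound C r u -> Rbar_le (/ r) (CV_radius u).
Proof.
  intros Hr Hu. apply (proj1 (CV_radius_bounded u)).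
  exists C. intros n. rewrite pow_inv, Rabs_mult, Rabs_inv.
  rewrite (Rabs_pos_eq (r ^ n)) by (apply pow_le; lra).
  assert (0 < r ^ n) by (apply pow_lt; lra).
  apply Rmult_le_reg_r with (r ^ n); [assumption|].
  rewrite Rmult_assoc, Rinv_l, Rmult_1_r by lra. apply Hu.
Qed.

Lemma geometric_CV_radius (u : nat -> R) :
  geometric u -> exists rho : R, 1 < rho /\
    forall x, Rabs x < rho -> Rbar_lt (Rabs x) (CV_radius u).
Proof.
  intros (C & r & Hr & Hu). exists (/ r). split.
  - rewrite <- Rinv_1. apply Rinv_lt_contravar; lra.
  - intros x Hx. eapply (Rbar_lt_le_trans (Rabs x) (/ r)); [exact Hx|].
    eapply geo_bound_CV_radius; [lra|exact Hu].
Qed.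

Lemma geometric_ex_series (u : nat -> R) : geometric u -> ex_series u.
Proof.
  intros (C & r & Hr & Hu). apply (geom_dominated_series C r u); [lra|exact Hu].
Qed.

(* Coefficients of [(p + q * x) * F x]. *)
Definition lin (p q : R) (u : nat -> R) (k : nat) : R :=
  p * u k + q * match k with O => 0 | S j => u j end.

Lemma PSeries_lin (p q x : R) (u : nat -> R) :
  ex_pseries u x -> PSeries (lin p q u) x = (p + q * x) * PSeries u x.
Proof.
  intros Hu.
  rewrite (PSeries_ext _ (PS_plus (PS_scal p u) (PS_scal q (PS_incr_1 u)))).
  - rewrite PSeries_plus, !PSeries_scal, PSeries_incr_1; [ring| |].
    + apply ex_pseries_scal; [apply Rmult_comm|exact Hu].
    + apply ex_pseries_scal; [apply Rmult_comm|now apply ex_pseries_incr_1].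
  - intros [|n]; reflexivity.
Qed.

Lemma geo_bound_lin (p q C r : R) (u : nat -> R) :
  0 < r -> geo_bound C r u -> geo_bound ((Rabs p + Rabs q / r) * C) r (lin p q u).
Proof.
  intros Hr Hu k. unfold lin. pose proof (geo_bound_pos _ _ _ Hu).
  eapply Rle_trans; [apply Rabs_triang|]. rewrite !Rabs_mult.
  assert (Hp : Rabs p * Rabs (u k) <= Rabs p * (C * r ^ k)).
  { apply Rmult_le_compat_l; [apply Rabs_pos|apply Hu]. }
  enough (Rabs q * Rabs match k with O => 0 | S j => u j end
          <= Rabs q / r * C * r ^ k) by lra.
  replace (Rabs q / r * C * r ^ k) with (Rabs q * (C * r ^ k / r)) by (field; lra).
  apply Rmult_le_compat_l; [apply Rabs_pos|].
  destruct k as [|j].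
  - rewrite Rabs_R0. simpl. rewrite Rmult_1_r.
    apply Rmult_le_pos; [lra|]. left; apply Rinv_0_lt_compat; lra.
  - replace (C * r ^ S j / r) with (C * r ^ j) by (simpl; field; lra). apply Hu.
Qed.

Lemma geometric_lin (p q : R) (u : nat -> R) : geometric u -> geometric (lin p q u).
Proof.
  intros (C & r & Hr & Hu). eexists _, r. split; [exact Hr|].
  apply geo_bound_lin; [lra|exact Hu].
Qed.

Definition mulX1 : (nat -> R) -> nat -> R := lin (-1) 1.

(* Coefficients of [(F x - F 1) / (x - 1)], where [F x] is the power series of [u]. *)
Definition divX1 (u : nat -> R) (k : nat) : R := Series (fun j => u (S k + j)%nat).

Lemma geometric_divX1 (u : nat -> R) : geometric u -> geometric (divX1 u).
Proof.
  intros (C & r & Hr & Hu). exists (C * r / (1 - r)), r. split; [exact Hr|].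
  intros k. unfold divX1.
  destruct (geom_dominated_series (C * r ^ S k) r (fun j => u (S k + j)%nat)) as [_ H].
  - lra.
  - intros j. rewrite Rmult_assoc, <- pow_add. apply Hu.
  - eapply Rle_trans; [exact H|]. apply Req_le. simpl. field. lra.
Qed.

(** Together with [divX1_S] this is the coefficient form of [F x = F 1 + (x - 1) * G x]: [u] is
    [mulX1 (divX1 u)] plus the constant [PSeries u 1] in degree zero. *)
Lemma divX1_0 (u : nat -> R) :
  geometric u -> u 0%nat = PSeries u 1 - divX1 u 0.
Proof.
  intros Hu. rewrite PSeries_1, Series_incr_1 by now apply geometric_ex_series.
  unfold divX1. simpl. ring.
Qed.

Lemma divX1_S (u : nat -> R) (k : nat) :
  geometric u -> u (S k) = divX1 u k - divX1 u (S k).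
Proof.
  intros Hu. unfold divX1.
  rewrite (Series_incr_1 (fun j => u (S k + j)%nat)).
  - rewrite Nat.add_0_r.
    rewrite (Series_ext (fun j => u (S k + S j)%nat) (fun j => u (S (S k) + j)%nat)).
    + ring.
    + intros j. f_equal. lia.
  - apply ex_series_incr_n. now apply geometric_ex_series.
Qed.

(** Convergence of the quotient series at [x] is assumed instead of [Rabs x <= 1], so that the
    identity holds on a full neighbourhood of [1] and can be differentiated there. *)
Lemma PSeries_divX1 (u : nat -> R) (x : R) :
  geometric u -> ex_pseries (divX1 u) x ->
  PSeries u x = PSeries u 1 + (x - 1) * PSeries (divX1 u) x.
Proof.
  intros Hu Hx.
  assert (Hm : ex_pseries (mulX1 (divX1 u)) x).
  { apply ex_pseries_ext with
      (PS_plus (PS_scal (-1) (divX1 u)) (PS_scal 1 (PS_incr_1 (divX1 u)))).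
    - intros [|n]; reflexivity.
    - apply (ex_pseries_plus (V := R_NormedModule)).
      + apply ex_pseries_scal; [apply Rmult_comm|exact Hx].
      + apply ex_pseries_scal; [apply Rmult_comm|now apply ex_pseries_incr_1]. }
  assert (E : forall k, u (S k) = mulX1 (divX1 u) (S k)).
  { intros k. unfold mulX1, lin. rewrite (divX1_S u k Hu). ring. }
  assert (Hux : ex_pseries u x).
  { apply ex_pseries_R. apply ex_series_incr_1. apply ex_pseries_R in Hm.
    apply ex_series_incr_1 in Hm. revert Hm. apply ex_series_ext.
    intros n. simpl. now rewrite <- E. }
  transitivity (PSeries u 1 + PSeries (mulX1 (divX1 u)) x).
  - rewrite (PSeries_decr_1 u x Hux), (PSeries_decr_1 _ x Hm).
    rewrite (PSeries_ext (PS_decr_1 u) (PS_decr_1 (mulX1 (divX1 u)))) by exact E.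
    rewrite (divX1_0 u Hu). unfold mulX1 at 2, lin. ring.
  - unfold mulX1. rewrite PSeries_lin by exact Hx. ring.
Qed.

Lemma geometric_lim_0 (u : nat -> R) : geometric u -> is_lim_seq u 0.
Proof.
  intros (C & r & Hr & Hu).
  apply is_lim_seq_abs_0.
  apply is_lim_seq_le_le with (fun _ => 0) (fun n => C * r ^ n).
  - intros n. split; [apply Rabs_pos|apply Hu].
  - apply is_lim_seq_const.
  - replace (Finite 0) with (Rbar_mult C 0) by (simpl; f_equal; ring).
    apply is_lim_seq_scal_l. apply is_lim_seq_geom. rewrite Rabs_pos_eq; lra.
Qed.

Lemma geometric_shift (u : nat -> R) (m : nat) :
  geometric u -> geometric (fun n => u (n + m)%nat).
Proof.
  intros (C & r & Hr & Hu). exists (C * r ^ m), r. split; [exact Hr|].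
  intros n. replace (C * r ^ m * r ^ n) with (C * r ^ (n + m)) by (rewrite pow_add; ring).
  apply Hu.
Qed.

Lemma is_series_telescope (h : nat -> R) :
  is_lim_seq h 0 -> is_series (fun n => h n - h (S n)) (h 0%nat).
Proof.
  intros Hh.
  assert (E : forall n, h 0%nat - h (S n) = sum_n (fun n => h n - h (S n)) n).
  { induction n as [|n IH].
    - now rewrite sum_O.
    - rewrite sum_Sn, <- IH. unfold plus; simpl. ring. }
  change (is_lim_seq (sum_n (fun n => h n - h (S n))) (h 0%nat)).
  apply is_lim_seq_ext with (1 := E).
  replace (Finite (h 0%nat)) with (Finite (h 0%nat - 0)) by (f_equal; ring).
  apply is_lim_seq_minus'; [apply is_lim_seq_const|].
  now apply is_lim_seq_incr_1 in Hh.
Qed.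

(** The function of [mulX1 u] vanishes at [1], so the division subtracts no value; on coefficients,
    the tail sums telescope. *)
Lemma divX1_mulX1 (u : nat -> R) : geometric u -> divX1 (mulX1 u) = u.
Proof.
  intros Hu. apply functional_extensionality. intros k. unfold divX1.
  apply is_series_unique.
  apply is_series_ext with (fun j => u (j + k)%nat - u (S j + k)%nat).
  - intros j. unfold mulX1, lin. simpl. rewrite (Nat.add_comm k j). ring.
  - apply (is_series_telescope (fun j => u (j + k)%nat)).
    now apply geometric_lim_0, geometric_shift.
Qed.

Lemma geometric_iter_divX1 (k : nat) (u : nat -> R) :
  geometric u -> geometric (Nat.iter k divX1 u).
Proof. intros Hu. induction k; simpl; auto using geometric_divX1. Qed.

Lemma geometric_iter_mulX1 (k : nat) (u : nat -> R) :
  geometric u -> geometric (Nat.iter k mulX1 u).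
Proof. intros Hu. induction k; simpl; [exact Hu|]. now apply geometric_lin. Qed.

Lemma iter_divX1_mulX1 (k : nat) (u : nat -> R) :
  geometric u -> Nat.iter k divX1 (Nat.iter k mulX1 u) = u.
Proof.
  revert u. induction k as [|k IH]; intros u Hu; [reflexivity|].
  rewrite Nat.iter_succ_r. simpl. rewrite divX1_mulX1; [now apply IH|].
  now apply geometric_iter_mulX1.
Qed.

Lemma geometric_ex_pseries (u : nat -> R) (x : R) :
  geometric u -> Rabs x <= 1 -> ex_pseries u x.
Proof.
  intros (C & r & Hr & Hu) Hx. apply (geo_bound_pseries C r x u); [lra| |exact Hu].
  pose proof (Rabs_pos x). nra.
Qed.

Lemma PSeries_iter_mulX1 (k : nat) (u : nat -> R) (x : R) :
  geometric u -> Rabs x <= 1 ->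
  PSeries (Nat.iter k mulX1 u) x = PSeries u x * (x - 1) ^ k.
Proof.
  intros Hu Hx. induction k as [|k IH]; simpl; [ring|].
  unfold mulX1 at 1. rewrite PSeries_lin, IH; [ring|].
  apply geometric_ex_pseries; [now apply geometric_iter_mulX1|exact Hx].
Qed.

(** Iterating [PSeries_divX1] gives the Taylor formula at [1] with exact remainder. The coefficients
    appear as values of iterated quotients; [Derive_n_PSeries_at_1] identifies them with
    derivatives. *)
Lemma PSeries_iter_divX1 (m : nat) (u : nat -> R) (x : R) :
  geometric u -> Rabs x <= 1 ->
  PSeries u x =
    sum_f_R0 (fun j => PSeries (Nat.iter j divX1 u) 1 * (x - 1) ^ j) m +
    (x - 1) ^ S m * PSeries (Nat.iter (S m) divX1 u) x.
Proof.
  intros Hu Hx.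
  assert (Hd : forall k, PSeries (Nat.iter k divX1 u) x =
    PSeries (Nat.iter k divX1 u) 1 + (x - 1) * PSeries (Nat.iter (S k) divX1 u) x).
  { intros k. apply PSeries_divX1; [now apply geometric_iter_divX1|].
    apply geometric_ex_pseries; [|exact Hx].
    now apply (geometric_iter_divX1 (S k)). }
  induction m as [|m IH].
  - pose proof (Hd 0%nat) as H. simpl in *. rewrite H. ring.
  - rewrite IH, (Hd (S m)). rewrite tech5. simpl pow. ring.
Qed.

(** * Taylor coefficients at [1] *)

Lemma locally_Rabs_lt (rho x : R) :
  Rabs x < rho -> locally x (fun y => Rabs y < rho).
Proof.
  intros Hx. assert (Hp : 0 < rho - Rabs x) by lra.
  exists (mkposreal _ Hp). intros y Hy.
  assert (Hy' : Rabs (y - x) < rho - Rabs x) by exact Hy.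
  pose proof (Rabs_triang_inv y x). lra.
Qed.

(** Leibniz rule with an affine factor: only two terms survive, and the order [S j] removes the
    constant [c]. At [x = 1] the first term vanishes as well. *)
Lemma Derive_n_mulX1 (c rho : R) (u : nat -> R) (j : nat) :
  (forall x, Rabs x < rho -> Rbar_lt (Rabs x) (CV_radius u)) ->
  forall x, Rabs x < rho ->
  Derive_n (fun t => c + (t - 1) * PSeries u t) (S j) x =
  (x - 1) * Derive_n (PSeries u) (S j) x + INR (S j) * Derive_n (PSeries u) j x.
Proof.
  intros Hu.
  assert (HD : forall k x, Rabs x < rho -> ex_derive (Derive_n (PSeries u) k) x).
  { intros k x Hx. apply (ex_derive_n_PSeries (S k)). now apply Hu. }
  induction j as [|j IH]; intros x Hx.
  - apply is_derive_unique.
    change (is_derive (fun t => c + (t - 1) * PSeries u t) x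
      ((x - 1) * Derive (PSeries u) x + 1 * PSeries u x)).
    auto_derive; [exact (HD 0%nat x Hx)|change (fun y => PSeries u y) with (PSeries u); ring].
  - change (Derive (Derive_n (fun t => c + (t - 1) * PSeries u t) (S j)) x =
      (x - 1) * Derive (Derive_n (PSeries u) (S j)) x
      + INR (S (S j)) * Derive (Derive_n (PSeries u) j) x).
    rewrite (Derive_ext_loc _ (fun t => (t - 1) * Derive_n (PSeries u) (S j) t
      + INR (S j) * Derive_n (PSeries u) j t)).
    + pose proof (Derive_correct _ _ (HD (S j) x Hx)) as HA.
      pose proof (Derive_correct _ _ (HD j x Hx)) as HB.
      change (Derive_n (PSeries u) (S j)) with (Derive (Derive_n (PSeries u) j)) in *.
      revert HA HB. generalize (Derive_n (PSeries u) j) as B.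
      intros B. generalize (Derive B) as A.
      intros A HA HB. apply is_derive_unique. rewrite (S_INR (S j)).
      evar_last.
      * apply (is_derive_plus (V := R_NormedModule)).
        -- apply (is_derive_mult (fun t => t - 1) A x 1 (Derive A x));
             [auto_derive; [exact I|ring]|exact HA|intros; apply Rmult_comm].
        -- apply is_derive_scal. exact HB.
      * unfold plus, mult; simpl. ring.
    + apply filter_imp with (2 := locally_Rabs_lt _ _ Hx). intros y Hy. now apply IH.
Qed.

(** Differentiating [F 1 + (x - 1) * G x] at [1] to order [S k] leaves [S k] times the [k]-th
    derivative of [G], and this factor turns [fact k] into [fact (S k)]. *)
Lemma Derive_n_PSeries_at_1 (k : nat) (u : nat -> R) :
  geometric u ->
  Derive_n (PSeries u) k 1 / INR (fact k) = PSeries (Nat.iter k divX1 u) 1.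
Proof.
  revert u. induction k as [|k IH]; intros u Hu; [simpl; field|].
  destruct (geometric_CV_radius _ (geometric_divX1 u Hu)) as (rho & Hrho & HR).
  rewrite Nat.iter_succ_r, <- IH by now apply geometric_divX1.
  rewrite (Derive_n_ext_loc _ (fun t => PSeries u 1 + (t - 1) * PSeries (divX1 u) t)).
  - rewrite (Derive_n_mulX1 _ rho _ _ HR) by (rewrite Rabs_R1; exact Hrho).
    replace (fact (S k)) with (S k * fact k)%nat by reflexivity.
    rewrite mult_INR. field. split; apply not_0_INR; [apply fact_neq_0|lia].
  - assert (H1 : Rabs 1 < rho) by (rewrite Rabs_R1; exact Hrho).
    apply filter_imp with (2 := locally_Rabs_lt _ _ H1).
    intros y Hy. apply PSeries_divX1; [exact Hu|]. now apply CV_radius_inside, HR.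
Qed.

(** * Cosine coefficients and the Jacobi integrals *)

Lemma continuous_PSeries_cos (u : nat -> R) (t : R) :
  geometric u -> continuous (fun t => PSeries u (cos t)) t.
Proof.
  intros Hu. apply (continuous_comp cos (PSeries u)).
  - apply continuity_pt_filterlim, continuity_cos.
  - apply continuity_pt_filterlim, PSeries_continuity.
    destruct (geometric_CV_radius u Hu) as (rho & Hrho & HR). apply HR.
    pose proof (COS_bound t). apply Rle_lt_trans with 1; [|exact Hrho].
    apply Rabs_le. lra.
Qed.

Lemma continuous_cos_scal (s t : R) : continuous (fun t => cos (s * t)) t.
Proof.
  apply (ex_derive_continuous (V := R_NormedModule)). auto_derive. exact I.
Qed.

(** For [s > 0] this is half the Fourier cosine coefficient of [PSeries u (cos t)]; the missing
    factor [2] is the weight [Wt false s]. *)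
Definition coef (u : nat -> R) (s : nat) : R :=
  RInt (fun t => PSeries u (cos t) * cos (INR s * t)) 0 PI / PI.

Lemma continuous_coef_integrand (u : nat -> R) (s t : R) :
  geometric u -> continuous (fun t => PSeries u (cos t) * cos (s * t)) t.
Proof.
  intros Hu. apply (continuous_mult (K := R_AbsRing)).
  - now apply continuous_PSeries_cos.
  - apply continuous_cos_scal.
Qed.

Lemma is_RInt_coef (u : nat -> R) (s : nat) :
  geometric u ->
  is_RInt (fun t => PSeries u (cos t) * cos (INR s * t)) 0 PI (PI * coef u s).
Proof.
  intros Hu. unfold coef.
  assert (E : forall v : R, PI * (v / PI) = v) by (intros; field; apply PI_neq0).
  rewrite E.
  apply (RInt_correct (V := R_CompleteNormedModule)).
  apply (ex_RInt_continuous (V := R_CompleteNormedModule)).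
  intros t _. now apply continuous_coef_integrand.
Qed.

Lemma is_RInt_cos_S (s : nat) : is_RInt (fun t => cos (INR (S s) * t)) 0 PI 0.
Proof.
  assert (Hs : INR (S s) <> 0) by (apply not_0_INR; lia).
  replace 0 with (minus (sin (INR (S s) * PI) / INR (S s)) (sin (INR (S s) * 0) / INR (S s))) at 2.
  - apply (is_RInt_derive (V := R_CompleteNormedModule)
      (fun t => sin (INR (S s) * t) / INR (S s))).
    + intros t _. revert Hs. generalize (INR (S s)). intros k Hs.
      auto_derive; [exact I|]. field. exact Hs.
    + intros t _. apply continuous_cos_scal.
  - replace (sin (INR (S s) * PI)) with 0.
    + rewrite Rmult_0_r, sin_0. apply Rplus_opp_r.
    + symmetry. apply sin_eq_0_1. exists (Z.of_nat (S s)). now rewrite INR_IZR_INZ.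
Qed.

(** The product formula for [cos t * cos (s * t)] shifts the index both ways, and [c] is orthogonal
    to cosines of positive index. The case [(p, q) = (1, 0)] yields the decay of the coefficients,
    the case [(1, -1)] the effect of dividing by [x - 1]. *)
Lemma coef_affine (c p q : R) (u v : nat -> R) (s : nat) :
  geometric u -> geometric v ->
  (forall x, Rabs x <= 1 -> PSeries u x = c + (p * x + q) * PSeries v x) ->
  coef u (S s) = p * (coef v (S (S s)) + coef v s) / 2 + q * coef v (S s).
Proof.
  intros Hu Hv Huv.
  apply Rmult_eq_reg_l with PI; [|apply PI_neq0].
  transitivity (c * 0 + (p / 2 * (PI * coef v (S (S s)) + PI * coef v s)
                         + q * (PI * coef v (S s)))); [|field].
  rewrite <- (is_RInt_unique _ _ _ _ (is_RInt_coef u (S s) Hu)).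
  apply is_RInt_unique.
  apply is_RInt_ext with
    (fun t => plus (scal c (cos (INR (S s) * t)))
       (plus (scal (p / 2) (plus (PSeries v (cos t) * cos (INR (S (S s)) * t))
                                 (PSeries v (cos t) * cos (INR s * t))))
             (scal q (PSeries v (cos t) * cos (INR (S s) * t))))).
  - intros t _. unfold plus, scal; cbn -[INR]. unfold mult; cbn -[INR].
    rewrite Huv.
    + replace (INR (S (S s)) * t) with (INR (S s) * t + t) by (rewrite (S_INR (S s)); ring).
      replace (INR s * t) with (INR (S s) * t - t) by (rewrite S_INR; ring).
      rewrite cos_plus, cos_minus. field.
    + apply Rabs_le. pose proof (COS_bound t). lra.
  - apply (is_RInt_plus (V := R_NormedModule)).
    + apply (is_RInt_scal (V := R_NormedModule)), is_RInt_cos_S.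
    + apply (is_RInt_plus (V := R_NormedModule)).
      * apply (is_RInt_scal (V := R_NormedModule)), (is_RInt_plus (V := R_NormedModule));
          now apply is_RInt_coef.
      * apply (is_RInt_scal (V := R_NormedModule)). now apply is_RInt_coef.
Qed.

Lemma coef_bound_const (C r : R) (u : nat -> R) (s : nat) :
  0 < r < 1 -> geo_bound C r u -> Rabs (coef u s) <= C / (1 - r).
Proof.
  intros Hr Hu. pose proof PI_RGT_0 as Hpi.
  assert (Hg : geometric u) by (exists C, r; now split).
  unfold coef. rewrite Rabs_div by apply PI_neq0. rewrite (Rabs_pos_eq PI) by lra.
  apply Rmult_le_reg_r with PI; [exact Hpi|].
  unfold Rdiv at 1. rewrite Rmult_assoc, Rinv_l, Rmult_1_r by apply PI_neq0.
  replace (C / (1 - r) * PI) with ((PI - 0) * (C / (1 - r))) by ring.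
  apply abs_RInt_le_const; [lra| |].
  - eexists. now apply is_RInt_coef.
  - intros t _. rewrite Rabs_mult, <- (Rmult_1_r (C / (1 - r))).
    pose proof (COS_bound t). pose proof (COS_bound (INR s * t)).
    assert (Hc : Rabs (cos t) <= 1) by (apply Rabs_le; lra).
    pose proof (Rabs_pos (cos t)). pose proof (geo_bound_pos _ _ _ Hu).
    apply Rmult_le_compat; try apply Rabs_pos; [|apply Rabs_le; lra].
    destruct (geo_bound_pseries C r (cos t) u) as [_ Hb]; [lra|nra|exact Hu|].
    eapply Rle_trans; [exact Hb|]. apply Rmult_le_compat_l; [assumption|].
    apply Rinv_le_contravar; [lra|]. nra.
Qed.

(* With [F x = u 0 + x * G x], the coefficient of [F] at [S s] is the mean of those of [G]
   at [s] and [S (S s)], while the coefficient bound improves by a factor [r]. *)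
Lemma coef_bound (r : R) (m : nat) : 0 < r < 1 ->
  forall C u s, geo_bound C r u -> (m <= s)%nat ->
  Rabs (coef u s) <= C / (1 - r) * r ^ m.
Proof.
  intros Hr. induction m as [|m IH]; intros C u s Hu Hs.
  - rewrite Rmult_1_r. now apply coef_bound_const.
  - destruct s as [|s]; [lia|].
    assert (Hd : geo_bound (C * r) r (PS_decr_1 u)).
    { intros n. rewrite Rmult_assoc. exact (Hu (S n)). }
    rewrite (coef_affine (u 0%nat) 1 0 u (PS_decr_1 u)).
    + pose proof (IH _ _ s Hd ltac:(lia)) as H1.
      pose proof (IH _ _ (S (S s)) Hd ltac:(lia)) as H2.
      replace (C / (1 - r) * r ^ S m) with (C * r / (1 - r) * r ^ m) by (simpl; field; lra).
      apply Rabs_le_between in H1, H2. apply Rabs_le. lra.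
    + now exists C, r.
    + now exists (C * r), r.
    + intros x Hx. rewrite PSeries_decr_1; [ring|].
      apply geometric_ex_pseries; [now exists C, r|exact Hx].
Qed.

Lemma geometric_coef (u : nat -> R) : geometric u -> geometric (coef u).
Proof.
  intros (C & r & Hr & Hu). exists (C / (1 - r)), r. split; [exact Hr|].
  intros s. now apply coef_bound.
Qed.

Lemma coef_divX1 (u : nat -> R) (s : nat) : geometric u ->
  coef u (S s) =
  (coef (divX1 u) (S (S s)) + coef (divX1 u) s) / 2 - coef (divX1 u) (S s).
Proof.
  intros Hu. rewrite (coef_affine (PSeries u 1) 1 (-1) u (divX1 u)).
  - field.
  - exact Hu.
  - now apply geometric_divX1.
  - intros x Hx. rewrite (PSeries_divX1 u x Hu); [ring|].
    apply geometric_ex_pseries; [now apply geometric_divX1|exact Hx].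
Qed.

(** * The substitution [x = cos t] with singular endpoints *)

Lemma acos_at_left_1 : filterlim acos (at_left 1) (locally 0).
Proof.
  apply filterlim_locally. intros eps.
  (* Capping at [PI] keeps [e] in the range where [cos] decreases, so [cos e < y] forces
     [acos y < e]. *)
  set (e := Rmin eps PI).
  pose proof PI_RGT_0 as Hpi. pose proof (cond_pos eps) as Heps.
  assert (He : 0 < e <= PI) by (split; [now apply Rmin_pos|apply Rmin_r]).
  assert (Hc : cos e < 1).
  { rewrite <- cos_0. apply cos_decreasing_1; lra. }
  exists (mkposreal (1 - cos e) (proj2 (Rlt_0_minus _ _) Hc)). intros y Hy Hy1.
  assert (Hb : Rabs (y - 1) < 1 - cos e) by exact Hy.
  apply Rabs_def2 in Hb. pose proof (COS_bound e).
  pose proof (acos_bound y) as Hay.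
  change (Rabs (acos y - 0) < eps). rewrite Rminus_0_r, Rabs_pos_eq by lra.
  apply Rlt_le_trans with e; [|apply Rmin_l].
  apply Rnot_le_lt. intros Hle.
  assert (Hcos : cos (acos y) <= cos e) by (apply cos_decr_1; lra).
  rewrite cos_acos in Hcos by lra. lra.
Qed.

Lemma acos_at_right_m1 : filterlim acos (at_right (-1)) (locally PI).
Proof.
  assert (H : filterlim (fun x => PI - acos (- x)) (at_right (-1)) (locally (PI - 0))).
  { apply (filterlim_comp _ _ _ (fun x => acos (- x)) (fun y => PI - y) _ (locally 0)).
    - apply filterlim_comp with (2 := acos_at_left_1).
      intros P [eps HP]. exists eps. intros y Hy Hy1. apply HP; [|lra].
      change (Rabs (- y - 1) < eps). replace (- y - 1) with (- (y - -1)) by ring.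
      rewrite Rabs_Ropp. exact Hy.
    - apply (ex_derive_continuous (V := R_NormedModule) (fun y => PI - y)).
      auto_derive. exact I. }
  rewrite Rminus_0_r in H. revert H. apply filterlim_ext.
  intros x. rewrite acos_opp. ring.
Qed.

Lemma is_derive_acos (x : R) :
  -1 < x < 1 -> is_derive acos x (- / sqrt (1 - x²)).
Proof.
  intros Hx. apply is_derive_Reals.
  replace (- / sqrt (1 - x²)) with (derive_pt acos x (derivable_pt_acos x Hx)).
  - apply (derive_pt_eq_1 _ _ _ (derivable_pt_acos x Hx)). reflexivity.
  - rewrite derive_pt_acos. field.
    apply Rgt_not_eq, sqrt_lt_R0. unfold Rsqr. nra.
Qed.

Lemma sqrt_1_minus_sqr_pos (x : R) : -1 < x < 1 -> 0 < sqrt (1 - x²).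
Proof. intros Hx. apply sqrt_lt_R0. unfold Rsqr. nra. Qed.

(* The substitution [x = cos t] on the open interval, where the integrand may be singular
   at both endpoints. *)
Lemma is_RInt_gen_acos (f w : R -> R) (l : R) :
  (forall t, continuous w t) ->
  is_RInt w 0 PI l ->
  (forall x, -1 < x < 1 -> f x = w (acos x) / sqrt (1 - x²)) ->
  is_RInt_gen f (at_right (-1)) (at_left 1) l.
Proof.
  intros Hw Hl Hf.
  assert (HI : forall t, is_RInt w 0 t (RInt w 0 t)).
  { intros t. apply (RInt_correct (V := R_CompleteNormedModule)).
    apply (ex_RInt_continuous (V := R_CompleteNormedModule)). intros; apply Hw. }
  set (H := fun t => RInt w 0 t).
  assert (HD : forall t, is_derive H t (w t)).
  { intros t. apply is_derive_RInt with 0; [|apply Hw].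
    apply filter_forall. exact HI. }
  (* The derivative of [acos] is negative, hence the sign: [- H (acos x)] is an antiderivative of
     [f], and its increment from [-1] to [1] is [H PI - H 0 = l]. *)
  assert (HDa : forall x, -1 < x < 1 ->
    is_derive (fun x => - H (acos x)) x (w (acos x) / sqrt (1 - x²))).
  { intros x Hx. evar_last.
    - apply (is_derive_opp (V := R_NormedModule)).
      apply (is_derive_comp (V := R_NormedModule) H acos);
        [apply HD|apply is_derive_acos, Hx].
    - unfold opp, scal; simpl. unfold mult; simpl. unfold Rdiv. ring. }
  assert (Hlim : forall (F : (R -> Prop) -> Prop) c, filterlim acos F (locally c) ->
    filterlim (fun x => - H (acos x)) F (locally (- H c))).
  { intros F c Hc. apply (filterlim_comp _ _ _ acos (fun t => - H t) _ _ _ Hc).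
    apply (continuous_opp (V := R_NormedModule) H).
    apply (ex_derive_continuous (V := R_NormedModule)). eexists; apply HD. }
  intros P HP.
  assert (HPl : filter_prod (at_right (-1)) (at_left 1)
    (fun ab => P (minus (- H (acos (snd ab))) (- H (acos (fst ab)))))).
  { apply (filterlim_comp_2 (G := locally (- H 0)) (H := locally (opp (- H PI)))
      (fun ab : R * R => - H (acos (snd ab))) (fun ab : R * R => opp (- H (acos (fst ab))))
      plus (I := locally l)); [| | |exact HP].
    - apply (filterlim_comp _ _ _ snd (fun x => - H (acos x)) _ _ _ filterlim_snd).
      apply Hlim, acos_at_left_1.
    - apply (filterlim_comp _ _ _ (fun ab : R * R => - H (acos (fst ab)))
          (fun y : R => opp y) _ (locally (- H PI))).
      + apply (filterlim_comp _ _ _ fst (fun x => - H (acos x)) _ _ _ filterlim_fst).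
        apply Hlim, acos_at_right_m1.
      + apply (filterlim_opp (V := R_NormedModule)).
    - replace l with (plus (- H 0) (opp (- H PI))).
      + apply (filterlim_plus (V := R_NormedModule)).
      + unfold plus, opp; simpl. unfold H.
        rewrite (is_RInt_unique _ _ _ _ Hl).
        rewrite (RInt_point (V := R_CompleteNormedModule)). unfold zero; simpl. ring. }
  assert (Hin : filter_prod (at_right (-1)) (at_left 1)
    (fun ab => -1 < fst ab < 1 /\ -1 < snd ab < 1)).
  { apply Filter_prod with (fun x => -1 < x < 1) (fun x => -1 < x < 1).
    - exists (mkposreal 2 Rlt_0_2). intros y Hy Hy1.
      assert (Hb : Rabs (y - -1) < 2) by exact Hy. apply Rabs_def2 in Hb. lra.
    - exists (mkposreal 2 Rlt_0_2). intros y Hy Hy1.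
      assert (Hb : Rabs (y - 1) < 2) by exact Hy. apply Rabs_def2 in Hb. lra.
    - now split. }
  unfold filtermapi.
  apply filter_imp with (2 := filter_and _ _ HPl Hin).
  intros [u v] [HPuv [Hu Hv]]. simpl in *.
  eexists; split; [|exact HPuv].
  assert (Hb : forall x, Rmin u v <= x <= Rmax u v -> -1 < x < 1).
  { intros x Hx. unfold Rmin, Rmax in Hx. destruct (Rle_dec u v); lra. }
  apply is_RInt_ext with (fun x => w (acos x) / sqrt (1 - x²)).
  - intros x Hx. symmetry. apply Hf, Hb. lra.
  - apply (is_RInt_derive (V := R_CompleteNormedModule) (fun x => - H (acos x))).
    + intros x Hx. now apply HDa, Hb.
    + intros x Hx. apply Hb in Hx. pose proof (sqrt_1_minus_sqr_pos x Hx).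
      apply (continuous_mult (K := R_AbsRing)).
      * apply (continuous_comp acos w); [|apply Hw].
        apply (ex_derive_continuous (V := R_NormedModule)).
        eexists; now apply is_derive_acos.
      * apply (ex_derive_continuous (V := R_NormedModule) (fun x => / sqrt (1 - x²))).
        unfold Rsqr in *. auto_derive. split; [nra|split; [|exact I]]. now apply Rgt_not_eq.
Qed.

Lemma Rpower_mhalf (y : R) : 0 < y -> Rpower y (-1/2) = / sqrt y.
Proof.
  intros Hy. replace (-1/2) with (- / 2) by field.
  now rewrite Rpower_Ropp, Rpower_sqrt.
Qed.

Lemma sqrt_1_minus_sqr (x : R) :
  -1 < x < 1 -> sqrt (1 - x²) = sqrt (1 - x) * sqrt (1 + x).
Proof.
  intros Hx. rewrite <- sqrt_mult by lra. f_equal. unfold Rsqr. ring.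
Qed.

(* [W / pi] times the integral of [F x * J_s x * (1 - x)^b * (1 + x)^(-1/2)],
   see [is_RInt_gen_Psi]. *)
Definition Psi (b : bool) (u : nat -> R) (s : nat) : R :=
  Wt b s * (if b then coef u s - coef u (S s) else coef u s).

Lemma geometric_Psi (b : bool) (u : nat -> R) : geometric u -> geometric (Psi b u).
Proof.
  intros Hu. destruct (geometric_coef u Hu) as (C & r & Hr & Hc).
  (* The factor [2] covers both the weight [Wt false s] and the difference of two coefficients. *)
  exists (2 * C), r. split; [exact Hr|]. intros s.
  pose proof (Hc s) as H1. pose proof (Hc (S s)) as H2.
  pose proof (geo_bound_pos _ _ _ Hc).
  assert (Hp : 0 <= C * r ^ s) by (apply Rmult_le_pos; [lra|apply pow_le; lra]).
  simpl pow in H2.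
  apply Rabs_le_between in H1, H2. apply Rabs_le.
  unfold Psi, Wt. destruct b; [|destruct s]; nra.
Qed.

(** The weight for [-1/2] is exactly the Jacobian of [x = cos t]; the one for [1/2] carries a
    further factor [1 - x]. Constraining [f] only on the open interval avoids the endpoints, where
    the quotients and [Rpower] take default values. *)
Lemma is_RInt_gen_Psi (b : bool) (u : nat -> R) (s : nat) (f : R -> R) :
  geometric u ->
  (forall x, -1 < x < 1 ->
     f x = PSeries u x * Jac b s x * Rpower (1 - x) (hv b) * Rpower (1 + x) (-1/2)) ->
  exists I, is_RInt_gen f (at_right (-1)) (at_left 1) I /\
            Wt b s / PI * I = Psi b u s.
Proof.
  intros Hu Hf.
  exists (PI * (if b then coef u s - coef u (S s) else coef u s)).
  split; [|unfold Psi; field; apply PI_neq0].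
  assert (Hs : forall x, -1 < x < 1 -> 0 < sqrt (1 - x) /\ 0 < sqrt (1 + x))
    by (intros x Hx; split; apply sqrt_lt_R0; lra).
  destruct b; cbn -[INR] in Hf.
  - apply is_RInt_gen_acos with (fun t => PSeries u (cos t) * cos (INR s * t)
      - PSeries u (cos t) * cos (INR (S s) * t)).
    + intros t. apply (continuous_minus (V := R_NormedModule));
        now apply continuous_coef_integrand.
    + rewrite Rmult_minus_distr_l.
      apply (is_RInt_minus (V := R_NormedModule)); now apply is_RInt_coef.
    + intros x Hx. rewrite (Hf x Hx), cos_acos by lra.
      destruct (Hs x Hx) as [H1 H2]. pose proof (acos_bound_lt x Hx) as Ha.
      rewrite Rpower_mhalf by lra. replace (1 / 2) with (/ 2) by field.
      rewrite Rpower_sqrt, sqrt_1_minus_sqr by lra.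
      assert (Hsin : 0 < sin (acos x / 2)) by (apply sin_gt_0; lra).
      (* [1 - cos t = 2 sin^2 (t/2)] turns the quotient into [cos (s t) - cos ((s+1) t)]. *)
      assert (Hx2 : sqrt (1 - x) * sqrt (1 - x) = 2 * (sin (acos x / 2) * sin (acos x / 2))).
      { rewrite sqrt_sqrt by lra. rewrite <- (cos_acos x) at 1 by lra.
        replace (acos x) with (2 * (acos x / 2)) at 1 by field. rewrite cos_2a_sin. ring. }
      replace (INR (S s) * acos x) with ((INR s + / 2) * acos x + acos x / 2)
        by (rewrite S_INR; field).
      replace (INR s * acos x) with ((INR s + / 2) * acos x - acos x / 2) by field.
      rewrite cos_plus, cos_minus.
      generalize dependent (sin (acos x / 2)). intros sn Hsn Hsq.
      (* After this multiplication [sqrt (1 - x)] occurs only squared, where [Hsq] expresses it by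
         the sine. *)
      apply Rmult_eq_reg_r with (sqrt (1 - x)); [|lra].
      field_simplify; [|lra|lra].
      replace (sqrt (1 - x) ^ 2) with (2 * (sn * sn)) by (rewrite <- Hsq; ring).
      field. lra.
  - apply is_RInt_gen_acos with (fun t => PSeries u (cos t) * cos (INR s * t)).
    + intros t. now apply continuous_coef_integrand.
    + now apply is_RInt_coef.
    + intros x Hx. rewrite (Hf x Hx), cos_acos by lra.
      destruct (Hs x Hx) as [H1 H2].
      rewrite !Rpower_mhalf by lra. rewrite sqrt_1_minus_sqr by lra. field. lra.
Qed.

(** * Summation against the level kernels *)

Definition transforms (A : nat -> nat -> R) (u v : nat -> R) : Prop :=
  forall s, is_series (fun z => u z * A z s) (v s).

(** Kernel powers grow polynomially in the row index. Asking for growth below every exponential is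
    stable under products without tracking degrees. Triangularity is what makes the truncated sum in
    [mprod] the full matrix product. *)
Definition subexponential (A : nat -> nat -> R) : Prop :=
  (forall z w, (z < w)%nat -> A z w = 0) /\
  forall rho, 1 < rho -> exists C, forall z w, Rabs (A z w) <= C * rho ^ z.

Lemma subexponential_bounded (A : nat -> nat -> R) (M : R) :
  (forall z w, (z < w)%nat -> A z w = 0) ->
  (forall z w, Rabs (A z w) <= M) -> subexponential A.
Proof.
  intros HA HM. split; [exact HA|]. intros rho Hrho. exists M. intros z w.
  pose proof (pow_R1_Rle rho z ltac:(lra)). pose proof (HM z w).
  pose proof (Rabs_pos (A z w)). nra.
Qed.

(** Bernoulli's inequality, used to absorb the number of terms of a finite sum into a slowly growing
    exponential. *)
Lemma succ_le_geom (h : R) (n : nat) : 0 < h <= 1 -> INR n + 1 <= / h * (1 + h) ^ n.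
Proof.
  intros Hh. pose proof (poly n h ltac:(lra)) as Hb.
  apply Rmult_le_reg_l with h; [lra|].
  rewrite <- Rmult_assoc, Rinv_r, Rmult_1_l by lra.
  pose proof (pos_INR n). nra.
Qed.

Lemma exists_pow_near_1 (r rho : R) (k : nat) : r < 1 -> 1 < rho -> 0 < r ->
  exists h, 0 < h <= 1 /\ (1 + h) ^ k <= rho /\ r * (1 + h) ^ k < 1.
Proof.
  intros Hr Hrho Hr0.
  (* The second entry is the midpoint of [1] and [/ r]; multiplied by [r] it stays below [1].
     Continuity of [(1 + h) ^ k] at [h = 0] then provides [h]. *)
  set (m := Rmin rho (/ 2 * (1 + / r))).
  assert (Hir : 1 < / r) by (rewrite <- Rinv_1; apply Rinv_lt_contravar; lra).
  assert (Hm : 1 < m) by (apply Rmin_glb_lt; lra).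
  assert (Hc : continuous (fun h => (1 + h) ^ k) 0).
  { apply (ex_derive_continuous (V := R_NormedModule)). auto_derive. exact I. }
  assert (Hl : locally 0 (fun h => (1 + h) ^ k < m)).
  { apply (Hc (fun y => y < m)). rewrite Rplus_0_r, pow1.
    apply (open_lt m 1 Hm). }
  destruct Hl as [eps Heps]. pose proof (cond_pos eps).
  exists (Rmin 1 (eps / 2)).
  assert (Hh : 0 < Rmin 1 (eps / 2) <= 1) by (split; [apply Rmin_pos; lra|apply Rmin_l]).
  assert (Hlt : (1 + Rmin 1 (eps / 2)) ^ k < m).
  { apply Heps. change (Rabs (Rmin 1 (eps / 2) - 0) < eps).
    rewrite Rabs_pos_eq by lra. pose proof (Rmin_r 1 (eps / 2)). lra. }
  pose proof (Rmin_l rho (/ 2 * (1 + / r))). pose proof (Rmin_r rho (/ 2 * (1 + / r))).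
  fold m in H0, H1. repeat split; try lra.
  apply Rlt_le_trans with (r * (/ 2 * (1 + / r))).
  - apply Rmult_lt_compat_l; lra.
  - replace (r * (/ 2 * (1 + / r))) with (/ 2 * (r + 1)) by (field; lra). lra.
Qed.

Lemma sum_f_R0_extend (f : nat -> R) (m n : nat) : (m <= n)%nat ->
  (forall i, (m < i <= n)%nat -> f i = 0) -> sum_f_R0 f n = sum_f_R0 f m.
Proof.
  intros Hmn. induction Hmn as [|n Hmn IH]; intros Hf; [reflexivity|].
  rewrite tech5, IH, Hf; [ring|lia|]. intros i Hi. apply Hf. lia.
Qed.

Lemma sum_f_R0_swap (f : nat -> nat -> R) (m n : nat) :
  sum_f_R0 (fun i => sum_f_R0 (f i) n) m = sum_f_R0 (fun j => sum_f_R0 (fun i => f i j) m) n.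
Proof.
  induction m as [|m IH]; [reflexivity|].
  rewrite tech5, IH. rewrite <- sum_plus. now apply sum_eq.
Qed.

Lemma sum_f_R0_abs_le (f : nat -> R) (M : R) (n : nat) :
  (forall i, Rabs (f i) <= M) -> Rabs (sum_f_R0 f n) <= (INR n + 1) * M.
Proof.
  intros Hf. rewrite <- S_INR, Rmult_comm, <- sum_cte.
  eapply Rle_trans; [apply Rsum_abs|]. now apply sum_Rle.
Qed.

Lemma subexponential_mprod (A B : nat -> nat -> R) :
  subexponential A -> subexponential B -> subexponential (mprod A B).
Proof.
  intros [HA1 HA2] [HB1 HB2]. split.
  - intros z w Hzw. unfold mprod. rewrite (sum_eq _ (fun _ => 0)).
    + rewrite sum_cte. ring.
    + intros i Hi. rewrite HB1 by lia. ring.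
  - intros rho Hrho.
    (* Three factors [1 + h] share the allowed growth [rho]: one for [A], one for [B], one for the
       number of terms. *)
    destruct (exists_pow_near_1 (/ 2) rho 3) as (h & Hh & Hr & _); [lra|lra|lra|].
    destruct (HA2 (1 + h)) as [CA HA]; [lra|].
    destruct (HB2 (1 + h)) as [CB HB]; [lra|].
    exists (/ h * CA * CB). intros z w. unfold mprod.
    assert (HCA : 0 <= CA).
    { pose proof (HA 0%nat 0%nat). pose proof (Rabs_pos (A 0%nat 0%nat)). simpl in H. lra. }
    assert (HCB : 0 <= CB).
    { pose proof (HB 0%nat 0%nat). pose proof (Rabs_pos (B 0%nat 0%nat)). simpl in H. lra. }
    assert (Hp : 0 <= (1 + h) ^ z) by (apply pow_le; lra).
    assert (Hi : 0 < / h) by (apply Rinv_0_lt_compat; lra).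
    eapply Rle_trans; [apply Rsum_abs|].
    eapply Rle_trans.
    { apply sum_Rle with (Bn := fun _ => CA * (1 + h) ^ z * (CB * (1 + h) ^ z)).
      intros i Hiz. rewrite Rabs_mult.
      apply Rmult_le_compat; try apply Rabs_pos; [apply HA|].
      eapply Rle_trans; [apply HB|]. apply Rmult_le_compat_l; [exact HCB|].
      apply Rle_pow; [lra|exact Hiz]. }
    rewrite sum_cte, S_INR.
    pose proof (succ_le_geom h z Hh) as Hz.
    assert (HP3 : (1 + h) ^ z * ((1 + h) ^ z * (1 + h) ^ z) <= rho ^ z).
    { rewrite <- !Rpow_mult_distr. apply pow_incr. split; [|simpl in Hr; lra].
      repeat apply Rmult_le_pos; lra. }
    apply Rle_trans with
      (CA * (1 + h) ^ z * (CB * (1 + h) ^ z) * (/ h * (1 + h) ^ z)).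
    + apply Rmult_le_compat_l; [|exact Hz].
      repeat apply Rmult_le_pos; assumption.
    + replace (CA * (1 + h) ^ z * (CB * (1 + h) ^ z) * (/ h * (1 + h) ^ z))
        with (/ h * CA * CB * ((1 + h) ^ z * ((1 + h) ^ z * (1 + h) ^ z))) by ring.
      apply Rmult_le_compat_l; [|exact HP3].
      repeat apply Rmult_le_pos; lra.
Qed.

Lemma subexponential_mpow (A : nat -> nat -> R) (k : nat) :
  subexponential A -> subexponential (mpow A k).
Proof.
  intros HA. induction k as [|k IH]; simpl.
  - apply subexponential_bounded with 1; intros z w; unfold idm.
    + intros H. destruct (Nat.eqb_spec z w); [lia|reflexivity].
    + destruct (Nat.eqb z w); rewrite ?Rabs_R1, ?Rabs_R0; lra.
  - now apply subexponential_mprod.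
Qed.

Lemma subexponential_Tm : subexponential Tm.
Proof.
  apply subexponential_bounded with 2; intros z w; unfold Tm.
  - intros H. now rewrite (proj2 (Nat.ltb_lt z w) H).
  - destruct (Nat.ltb z w); [|destruct w]; apply Rabs_le; lra.
Qed.

Lemma subexponential_phim : subexponential phim.
Proof.
  apply subexponential_bounded with 1; intros z w; unfold phim.
  - intros H. destruct (Nat.ltb_spec w z); [lia|reflexivity].
  - destruct (Nat.ltb w z); apply Rabs_le; lra.
Qed.

(* Exchanging the two summations leaves the error [sum_(w <= Z) B w s * (tail at Z of
   sum_z u z * A z w)], which is at most [(Z + 1)] times a geometrically small quantity. *)
Lemma transforms_mprod (A B : nat -> nat -> R) (u v w : nat -> R) :
  geometric u -> subexponential A -> subexponential B ->
  transforms A u v -> transforms B v w -> transforms (mprod A B) u w.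
Proof.
  intros (C & r & Hr & Hu) [HA1 HA2] [HB1 HB2] HA HB s.
  (* The decay [r] must outweigh three factors [1 + h]: the growth of [A], that of [B], and the
     [Z + 1] terms of the error. The first is merged into [q] below. *)
  destruct (exists_pow_near_1 r 2 3) as (h & Hh & _ & Hrh); [lra|lra|lra|].
  destruct (HA2 (1 + h)) as [CA HAb]; [lra|].
  destruct (HB2 (1 + h)) as [CB HBb]; [lra|].
  assert (HC : 0 <= C) by apply (geo_bound_pos _ _ _ Hu).
  assert (HCA : 0 <= CA).
  { pose proof (HAb 0%nat 0%nat). pose proof (Rabs_pos (A 0%nat 0%nat)). simpl in H. lra. }
  assert (HCB : 0 <= CB).
  { pose proof (HBb 0%nat 0%nat). pose proof (Rabs_pos (B 0%nat 0%nat)). simpl in H. lra. }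
  assert (Hi : 0 < / h) by (apply Rinv_0_lt_compat; lra).
  set (q := r * (1 + h)).
  assert (Hq : 0 < q < 1).
  { unfold q. simpl in Hrh.
    assert (1 <= (1 + h) * ((1 + h) * 1)) by nra.
    assert (0 < r * (1 + h)) by (apply Rmult_lt_0_compat; lra).
    split; [assumption|]. nra. }
  assert (HuA : forall j, geo_bound (C * CA) q (fun z => u z * A z j)).
  { intros j z. unfold q. rewrite Rabs_mult, Rpow_mult_distr.
    replace (C * CA * (r ^ z * (1 + h) ^ z)) with (C * r ^ z * (CA * (1 + h) ^ z)) by ring.
    apply Rmult_le_compat; try apply Rabs_pos; [apply Hu|apply HAb]. }
  assert (Htail : forall Z j,
    Rabs (v j - sum_f_R0 (fun z => u z * A z j) Z) <= C * CA * q ^ S Z / (1 - q)).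
  { intros Z j. rewrite <- (is_series_unique _ _ (HA j)).
    rewrite (Series_incr_n _ (S Z)); [|lia|eexists; apply HA]. simpl pred.
    match goal with |- Rabs (?a + ?b - ?a) <= _ => replace (a + b - a) with b by ring end.
    apply (geom_dominated_series (C * CA * q ^ S Z) q); [lra|].
    intros k. rewrite Rmult_assoc, <- pow_add. apply HuA. }
  assert (Hsum : forall Z, sum_f_R0 (fun z => u z * mprod A B z s) Z =
    sum_f_R0 (fun j => v j * B j s) Z
    - sum_f_R0 (fun j => B j s * (v j - sum_f_R0 (fun z => u z * A z j) Z)) Z).
  { intros Z. rewrite <- minus_sum.
    transitivity (sum_f_R0 (fun z => sum_f_R0 (fun j => u z * A z j * B j s) Z) Z).
    - apply sum_eq. intros z Hz. unfold mprod. rewrite scal_sum.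
      rewrite (sum_f_R0_extend (fun j => u z * A z j * B j s) z Z Hz).
      + apply sum_eq. intros. ring.
      + intros j Hj. rewrite HA1 by lia. ring.
    - rewrite sum_f_R0_swap. apply sum_eq. intros j _.
      rewrite <- (Rmult_comm (B j s)), Rmult_minus_distr_l.
      replace (B j s * v j - _) with (B j s * sum_f_R0 (fun z => u z * A z j) Z) by ring.
      rewrite scal_sum. now apply sum_eq. }
  assert (Herr : is_lim_seq (fun Z =>
    sum_f_R0 (fun j => B j s * (v j - sum_f_R0 (fun z => u z * A z j) Z)) Z) 0).
  { apply geometric_lim_0.
    exists (/ h * CB * (C * CA * q / (1 - q))), (q * (1 + h) * (1 + h)).
    assert (Hq3 : 0 < q * (1 + h) * (1 + h)) by (repeat apply Rmult_lt_0_compat; lra).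
    split; [unfold q in *; simpl in Hrh; split; lra|]. intros Z.
    (* [sum_f_R0_abs_le] wants one bound for all indices, but [B j s] is controlled by [(1 + h) ^ Z]
       only for [j <= Z]; the terms beyond are set to [0]. *)
    rewrite (sum_eq _ (fun j => if Nat.leb j Z then
      B j s * (v j - sum_f_R0 (fun z => u z * A z j) Z) else 0)).
    2:{ intros i Hile. now rewrite (proj2 (Nat.leb_le i Z) Hile). }
    assert (HM : 0 <= C * CA * q ^ S Z / (1 - q)).
    { eapply Rle_trans; [apply Rabs_pos|exact (Htail Z 0%nat)]. }
    assert (Hp : 0 <= (1 + h) ^ Z) by (apply pow_le; lra).
    eapply Rle_trans; [apply sum_f_R0_abs_le with
      (M := CB * (1 + h) ^ Z * (C * CA * q ^ S Z / (1 - q)))|].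
    - intros j. destruct (Nat.leb_spec j Z) as [Hj|Hj].
      + rewrite Rabs_mult. apply Rmult_le_compat; try apply Rabs_pos; [|apply Htail].
        eapply Rle_trans; [apply HBb|]. apply Rmult_le_compat_l; [exact HCB|].
        apply Rle_pow; [lra|exact Hj].
      + rewrite Rabs_R0. apply Rmult_le_pos; [apply Rmult_le_pos|]; assumption.
    - eapply Rle_trans.
      + apply Rmult_le_compat_r; [apply Rmult_le_pos; [apply Rmult_le_pos|]; assumption|].
        apply (succ_le_geom h Z Hh).
      + apply Req_le. rewrite !Rpow_mult_distr. simpl. field. lra. }
  assert (Hmain : is_lim_seq (fun Z => sum_f_R0 (fun z => u z * mprod A B z s) Z) (w s - 0)).
  { apply is_lim_seq_ext with (1 := fun Z => eq_sym (Hsum Z)).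
    apply is_lim_seq_minus'; [|exact Herr].
    apply is_lim_seq_ext with (2 := HB s). intros n. apply sum_n_Reals. }
  rewrite Rminus_0_r in Hmain.
  apply is_lim_seq_ext with (2 := Hmain). intros n. symmetry. apply sum_n_Reals.
Qed.

(** * Action of the kernels on the level functions *)

Lemma transforms_idm (u : nat -> R) : transforms idm u u.
Proof.
  intros s. replace (u s) with ((fun n => if Nat.leb n s then u s else 0) 0%nat) by reflexivity.
  apply is_series_ext with (fun n => (if Nat.leb n s then u s else 0)
    - (if Nat.leb (S n) s then u s else 0)).
  - intros n. unfold idm.
    destruct (Nat.leb_spec n s), (Nat.leb_spec (S n) s), (Nat.eqb_spec n s);
      try lia; subst; match goal with |- ?a = ?b => change (@eq R a b) end; ring.
  - apply (is_series_telescope (fun n => if Nat.leb n s then u s else 0)).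
    apply is_lim_seq_ext_loc with (fun _ => 0); [|apply is_lim_seq_const].
    exists (S s). intros n Hn. destruct (Nat.leb_spec n s); [lia|reflexivity].
Qed.

Lemma is_series_telescope_from (f h : nat -> R) (s : nat) :
  is_lim_seq h 0 ->
  (forall z, (z < s)%nat -> f z = 0) ->
  (forall z, (s <= z)%nat -> f z = h z - h (S z)) ->
  is_series f (h s).
Proof.
  intros Hh H0 H1.
  (* Clamping the index at [s] makes the differences vanish below [s], so the telescoping series can
     start at [0]. *)
  replace (h s) with ((fun n => h (Nat.max n s)) 0%nat) by reflexivity.
  apply is_series_ext with (fun n => h (Nat.max n s) - h (Nat.max (S n) s)).
  - intros n. destruct (Nat.lt_ge_cases n s) as [Hn|Hn].
    + rewrite H0 by exact Hn. rewrite !Nat.max_r by lia. apply Rminus_diag.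
    + rewrite H1 by exact Hn. now rewrite !Nat.max_l by lia.
  - apply (is_series_telescope (fun n => h (Nat.max n s))).
    apply is_lim_seq_ext_loc with (2 := Hh). exists s. intros n Hn.
    now rewrite Nat.max_l by lia.
Qed.

(** From row [s] on, column [s] of [Tm] is the constant [Wt false s], while [Psi true u] is already
    a first difference. *)
Lemma transforms_Tm (u : nat -> R) :
  geometric u -> transforms Tm (Psi true u) (Psi false u).
Proof.
  intros Hu s. unfold Psi at 2.
  apply is_series_telescope_from with (h := fun z => Wt false s * coef u z).
  - replace (Finite 0) with (Rbar_mult (Wt false s) 0) by (simpl; f_equal; ring).
    now apply is_lim_seq_scal_l, geometric_lim_0, geometric_coef.
  - intros z Hz. rewrite (proj1 subexponential_Tm) by exact Hz. ring.
  - intros z Hz. unfold Psi, Tm, Wt. destruct (Nat.ltb_spec z s); [lia|].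
    destruct s; ring.
Qed.

(** The strict inequality in [phim] starts the sum at [S s], away from index [0], so [coef_divX1]
    always applies. There the weight [2] cancels the half, leaving a second difference of [c], that
    is, a difference of [c (pred z) - c z]. *)
Lemma transforms_phim (u : nat -> R) :
  geometric u -> transforms phim (Psi false u) (Psi true (divX1 u)).
Proof.
  intros Hu s.
  pose proof (geometric_coef _ (geometric_divX1 u Hu)) as Hc.
  set (c := coef (divX1 u)) in *.
  replace (Psi true (divX1 u) s) with ((fun z => c (pred z) - c z) (S s))
    by (unfold Psi, Wt; fold c; simpl; ring).
  apply is_series_telescope_from with (h := fun z => c (pred z) - c z).
  - apply is_lim_seq_incr_1. simpl. apply geometric_lim_0 in Hc.
    replace (Finite 0) with (Finite (0 - 0)) by (f_equal; ring).
    apply is_lim_seq_minus'; [exact Hc|]. now apply is_lim_seq_incr_1 in Hc.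
  - intros z Hz. unfold phim. destruct (Nat.ltb_spec s z); [lia|ring].
  - intros z Hz. unfold phim. destruct (Nat.ltb_spec s z); [|lia].
    destruct z as [|z]; [lia|]. unfold Psi, Wt. rewrite (coef_divX1 u z Hu).
    fold c. simpl. field.
Qed.

Lemma transforms_mpow_Tm_phim (u : nat -> R) (k : nat) : geometric u ->
  transforms (mpow (mprod Tm phim) k) (Psi true u) (Psi true (Nat.iter k divX1 u)).
Proof.
  intros Hu. pose proof subexponential_Tm. pose proof subexponential_phim.
  induction k as [|k IH]; simpl; [apply transforms_idm|].
  pose proof (geometric_iter_divX1 k u Hu).
  eapply transforms_mprod; [|apply subexponential_mpow| |exact IH|];
    auto using geometric_Psi, subexponential_mprod.
  eapply transforms_mprod; [| | |now apply transforms_Tm|now apply transforms_phim];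
    auto using geometric_Psi.
Qed.

Lemma transforms_mpow_phim_Tm (u : nat -> R) (k : nat) : geometric u ->
  transforms (mpow (mprod phim Tm) k) (Psi false u) (Psi false (Nat.iter k divX1 u)).
Proof.
  intros Hu. pose proof subexponential_Tm. pose proof subexponential_phim.
  induction k as [|k IH]; simpl; [apply transforms_idm|].
  pose proof (geometric_iter_divX1 k u Hu).
  eapply transforms_mprod; [|apply subexponential_mpow| |exact IH|];
    auto using geometric_Psi, subexponential_mprod.
  eapply transforms_mprod; [| | |now apply transforms_phim|];
    auto using geometric_Psi, transforms_Tm, geometric_divX1.
Qed.

(** In all four cases the kernel contains exactly [n2 - n1] factors [phim], hence as many divisions
    by [x - 1]. *)
Lemma transforms_phiL (u : nat -> R) (n1 n2 : nat) (b1 b2 : bool) :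
  geometric u -> 2 * INR n1 + hv b1 < 2 * INR n2 + hv b2 ->
  transforms (phiL n1 b1 n2 b2) (Psi b2 u) (Psi b1 (Nat.iter (n2 - n1) divX1 u)).
Proof.
  intros Hu Hlt. pose proof subexponential_Tm. pose proof subexponential_phim.
  destruct b1, b2; unfold phiL.
  - now apply transforms_mpow_Tm_phim.
  (* Here the order of the levels forces [n1 < n2], so the truncated [n2 - n1 - 1] is exact and the
     final [phim] supplies the remaining division. *)
  - assert (Hn : (n1 < n2)%nat) by (apply INR_lt; simpl in Hlt; lra).
    assert (E : Nat.iter (n2 - n1) divX1 u = divX1 (Nat.iter (n2 - n1 - 1) divX1 u)).
    { rewrite <- Nat.iter_succ. f_equal. lia. }
    rewrite E.
    apply transforms_mprod with (Psi false (Nat.iter (n2 - n1 - 1) divX1 u)).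
    + now apply geometric_Psi.
    + now apply subexponential_mpow, subexponential_mprod.
    + assumption.
    + now apply transforms_mpow_phim_Tm.
    + now apply transforms_phim, geometric_iter_divX1.
  - apply transforms_mprod with (Psi true (Nat.iter (n2 - n1) divX1 u)).
    + now apply geometric_Psi.
    + now apply subexponential_mpow, subexponential_mprod.
    + assumption.
    + now apply transforms_mpow_Tm_phim.
    + now apply transforms_Tm, geometric_iter_divX1.
  - now apply transforms_mpow_phim_Tm.
Qed.

(** * The function [E] as a power series *)

Lemma is_lim_seq_Series_tail (t : nat -> R) :
  ex_series t -> is_lim_seq (fun n => Series (fun i => t (n + i)%nat)) 0.
Proof.
  intros Ht. apply is_lim_seq_incr_1.
  apply is_lim_seq_ext with (fun n => Series t - sum_n t n).
  - intros n. rewrite (Series_incr_n t (S n)) by (lia || exact Ht).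
    simpl pred. rewrite sum_n_Reals.
    match goal with |- ?a + ?b - ?a = _ => change (a + b - a = b); ring end.
  - replace (Finite 0) with (Finite (Series t - Series t)) by (f_equal; ring).
    apply is_lim_seq_minus'; [apply is_lim_seq_const|]. exact (Series_correct t Ht).
Qed.

Lemma ex_series_tail (t : nat -> R) (n : nat) :
  ex_series t -> ex_series (fun i => t (n + i)%nat).
Proof. intros Ht. now apply ex_series_incr_n. Qed.

Lemma Series_tail_S (t : nat -> R) (n : nat) : ex_series t ->
  Series (fun i => t (n + i)%nat) = t n + Series (fun i => t (S n + i)%nat).
Proof.
  intros Ht. rewrite Series_incr_1 by now apply ex_series_tail.
  rewrite Nat.add_0_r. f_equal. apply Series_ext. intros i. f_equal. lia.
Qed.

Lemma Series_nonneg (t : nat -> R) :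
  (forall i, 0 <= t i) -> ex_series t -> 0 <= Series t.
Proof.
  intros H0 Ht. rewrite <- (Rmult_0_l (Series t)), <- Series_scal_l.
  apply Series_le; [|exact Ht]. intros i. specialize (H0 i). lra.
Qed.

Lemma geo_bound_le (C C' r : R) (u : nat -> R) :
  0 < r -> C <= C' -> geo_bound C r u -> geo_bound C' r u.
Proof.
  intros Hr HC Hu n. eapply Rle_trans; [apply Hu|].
  apply Rmult_le_compat_r; [apply pow_le; lra|exact HC].
Qed.

Lemma geo_bound_plus (C C' r : R) (u v : nat -> R) :
  geo_bound C r u -> geo_bound C' r v -> geo_bound (C + C') r (fun n => u n + v n).
Proof.
  intros Hu Hv n. eapply Rle_trans; [apply Rabs_triang|].
  specialize (Hu n). specialize (Hv n). lra.
Qed.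

(** Passage to the infinite product: summable increments give limits of the coefficients with the
    same rate [r], and the tail of [t] bounds the error of the evaluated series. *)
Lemma geo_bound_limit (P : nat -> nat -> R) (t : nat -> R) (K r : R) :
  0 < r -> ex_series t ->
  (forall n, geo_bound K r (P n)) ->
  (forall n, geo_bound (t n) r (fun k => P (S n) k - P n k)) ->
  exists (e : nat -> R) (C : R), geo_bound C r e /\
    forall x, r * Rabs x < 1 ->
      is_lim_seq (fun n => PSeries (P n) x) (PSeries e x).
Proof.
  intros Hr Ht HP HD.
  set (d := fun k i => P (S i) k - P i k).
  assert (Htr : forall k, ex_series (fun i => t i * r ^ k)).
  { intros k. apply ex_series_scal_r. exact Ht. }
  assert (Hd : forall k n, ex_series (fun i => Rabs (d k (n + i)%nat)) /\
    Rabs (Series (fun i => d k (n + i)%nat)) <= Series (fun i => t (n + i)%nat) * r ^ k).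
  { intros k n.
    assert (Hex : ex_series (fun i => t (n + i)%nat * r ^ k)).
    { apply (ex_series_tail (fun i => t i * r ^ k) n (Htr k)). }
    assert (Ha : ex_series (fun i => Rabs (d k (n + i)%nat))).
    { apply (@ex_series_le R_AbsRing R_CompleteNormedModule) with
        (fun i => t (n + i)%nat * r ^ k); [|exact Hex].
      intros i. change (Rabs (Rabs (d k (n + i)%nat)) <= t (n + i)%nat * r ^ k).
      rewrite Rabs_Rabsolu. apply HD. }
    split; [exact Ha|]. eapply Rle_trans; [now apply Series_Rabs|].
    rewrite <- Series_scal_r. apply Series_le; [|exact Hex].
    intros i. split; [apply Rabs_pos|apply HD]. }
  assert (Hdex : forall k, ex_series (d k)).
  { intros k. apply ex_series_Rabs. apply (Hd k 0%nat). }
  set (e := fun k => P 0%nat k + Series (d k)).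
  assert (He : forall n k, e k - P n k = Series (fun i => d k (n + i)%nat)).
  { intros n k. induction n as [|n IH].
    - unfold e. simpl. rewrite (Series_ext (fun i => d k i) (d k)) by reflexivity.
      ring.
    - rewrite Series_tail_S in IH by apply Hdex. unfold d at 1 in IH. lra. }
  assert (Hb : forall n, geo_bound (Series (fun i => t (n + i)%nat)) r (fun k => e k - P n k)).
  { intros n k. rewrite He. apply Hd. }
  assert (Heb : geo_bound (Series (fun i => t (0 + i)%nat) + K) r e).
  { intros k. replace (e k) with (e k - P 0%nat k + P 0%nat k) by ring.
    exact (geo_bound_plus _ _ _ _ _ (Hb 0%nat) (HP 0%nat) k). }
  exists e, (Series (fun i => t (0 + i)%nat) + K). split; [exact Heb|].
  intros x Hx.
  assert (Hlim : is_lim_seq (fun n => PSeries e x - PSeries (P n) x) 0).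
  { apply is_lim_seq_abs_0.
    apply is_lim_seq_le_le with (fun _ => 0)
      (fun n => Series (fun i => t (n + i)%nat) * / (1 - r * Rabs x)).
    - intros n. split; [apply Rabs_pos|].
      rewrite <- PSeries_minus.
      + apply (geo_bound_pseries _ r x); [exact Hr|exact Hx|exact (Hb n)].
      + now apply (geo_bound_pseries _ r x e Hr Hx Heb).
      + now apply (geo_bound_pseries _ r x _ Hr Hx (HP n)).
    - apply is_lim_seq_const.
    - replace (Finite 0) with (Rbar_mult 0 (/ (1 - r * Rabs x))) by (simpl; f_equal; ring).
      apply is_lim_seq_scal_r. now apply is_lim_seq_Series_tail. }
  apply is_lim_seq_ext with (fun n => PSeries e x - (PSeries e x - PSeries (P n) x)).
  - intros n. ring.
  - replace (Finite (PSeries e x)) with (Finite (PSeries e x - 0)) by (f_equal; ring).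
    apply is_lim_seq_minus'; [apply is_lim_seq_const|exact Hlim].
Qed.

(* Coefficients of the quotient of a power series by [1 + a - a * x]. *)
Fixpoint divlin (a : R) (u : nat -> R) (k : nat) : R :=
  match k with
  | O => u 0%nat / (1 + a)
  | S j => (u (S j) + a * divlin a u j) / (1 + a)
  end.

Lemma lin_divlin (a : R) (u : nat -> R) (k : nat) :
  0 <= a -> lin (1 + a) (- a) (divlin a u) k = u k.
Proof. intros Ha. unfold lin. destruct k; simpl; field; lra. Qed.

(** For [a > 0], [a * h <= / 2] puts the pole [1 + 1 / a] beyond the radius [1 + h], so the rate
    survives. The constant grows by [1 + 2 * a], close enough to [1] for the product over summable
    [a] to stay bounded. *)
Lemma geo_bound_divlin (a h C : R) (u : nat -> R) :
  0 <= a -> 0 < h <= 1 -> a * h <= / 2 ->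
  geo_bound C (/ (1 + h)) u -> geo_bound (C * (1 + 2 * a)) (/ (1 + h)) (divlin a u).
Proof.
  intros Ha Hh Hah Hu. pose proof (geo_bound_pos _ _ _ Hu) as HC.
  set (r := / (1 + h)) in *.
  assert (Hr : 0 < r) by (apply Rinv_0_lt_compat; lra).
  intros k. induction k as [|k IH].
  - specialize (Hu 0%nat). simpl in *. rewrite Rabs_div by lra.
    rewrite (Rabs_pos_eq (1 + a)) by lra.
    apply Rmult_le_reg_r with (1 + a); [lra|].
    unfold Rdiv. rewrite Rmult_assoc, Rinv_l by lra.
    assert (0 <= C * a) by (apply Rmult_le_pos; assumption).
    assert (0 <= C * a * a) by (apply Rmult_le_pos; assumption). nra.
  - simpl divlin. rewrite Rabs_div by lra. rewrite (Rabs_pos_eq (1 + a)) by lra.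
    apply Rmult_le_reg_r with (1 + a); [lra|].
    unfold Rdiv. rewrite Rmult_assoc, Rinv_l, Rmult_1_r by lra.
    eapply Rle_trans; [apply Rabs_triang|]. rewrite Rabs_mult, (Rabs_pos_eq a) by lra.
    apply Rle_trans with (C * r ^ S k + a * (C * (1 + 2 * a) * r ^ k)).
    + apply Rplus_le_compat; [apply Hu|]. now apply Rmult_le_compat_l.
    + replace (r ^ k) with ((1 + h) * r ^ S k) by (unfold r; simpl; field; lra).
      assert (Hp : 0 <= C * r ^ S k) by (apply Rmult_le_pos; [lra|apply pow_le; lra]).
      assert (Hin : 1 + a * ((1 + 2 * a) * (1 + h)) <= (1 + 2 * a) * (1 + a)).
      { assert (a * (h + 2 * (a * h)) <= a * 2) by (apply Rmult_le_compat_l; lra). nra. }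
      apply Rmult_le_compat_l with (1 := Hp) in Hin. lra.
Qed.

Lemma pow_div_fact_le_exp (y : R) (k : nat) : 0 <= y -> y ^ k / INR (fact k) <= exp y.
Proof.
  intros Hy. apply Rle_trans with (2 := exp_ge_taylor y k Hy).
  destruct k as [|k]; [simpl; lra|]. rewrite tech5.
  enough (0 <= sum_f_R0 (fun i => y ^ i / INR (fact i)) k) by lra.
  apply cond_pos_sum. intros i. apply Rmult_le_pos; [now apply pow_le|].
  left. apply Rinv_0_lt_compat, INR_fact_lt_0.
Qed.

Definition expX1 (g : R) (k : nat) : R := exp (- g) * (g ^ k / INR (fact k)).

Lemma geo_bound_expX1 (g r : R) :
  0 <= g -> 0 < r -> geo_bound (exp (- g) * exp (g / r)) r (expX1 g).
Proof.
  intros Hg Hr k. unfold expX1. pose proof (exp_pos (- g)).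
  assert (Hk : 0 <= g ^ k / INR (fact k)).
  { apply Rmult_le_pos; [now apply pow_le|].
    left. apply Rinv_0_lt_compat, INR_fact_lt_0. }
  rewrite Rabs_pos_eq by (apply Rmult_le_pos; lra).
  rewrite Rmult_assoc. apply Rmult_le_compat_l; [lra|].
  assert (Hgr : 0 <= g / r) by (apply Rmult_le_pos; [lra|left; now apply Rinv_0_lt_compat]).
  pose proof (pow_div_fact_le_exp (g / r) k Hgr) as Hle.
  apply Rmult_le_compat_r with (r := r ^ k) in Hle; [|apply pow_le; lra].
  eapply Rle_trans; [|exact Hle]. apply Req_le.
  unfold Rdiv. rewrite Rpow_mult_distr, pow_inv. field.
  split; [apply INR_fact_neq_0|apply pow_nonzero; lra].
Qed.

Lemma PSeries_expX1 (g x : R) : PSeries (expX1 g) x = exp (g * (x - 1)).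
Proof.
  replace (g * (x - 1)) with (- g + g * x) by ring. rewrite exp_plus.
  apply is_series_unique. unfold expX1.
  apply is_series_ext with (fun k => scal (exp (- g)) (/ INR (fact k) * (g * x) ^ k)).
  - intros k. rewrite Rpow_mult_distr. unfold scal; simpl. unfold mult; simpl.
    unfold Rdiv. match goal with |- ?a = ?b => change (@eq R a b) end. ring.
  - apply (is_series_scal (V := R_NormedModule)).
    apply (proj1 (is_pseries_R _ _ _)), is_exp_Reals.
Qed.

(* Coefficients of [exp (g * (x - 1))] times the [n]-th partial product of [E]. *)
Fixpoint Ecoef (g : R) (a b : nat -> R) (n : nat) : nat -> R :=
  match n with
  | O => expX1 g
  | S m => divlin (a m) (lin (1 - b m) (b m) (Ecoef g a b m))
  end.

(* The constant [K] is uniform in [n] since step [n] multiplies the bound by at most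
   [(1 + b n) * (1 + 2 * a n)]. *)
Lemma Ecoef_bounds (g h : R) (a b : nat -> R) :
  0 <= g -> 0 < h <= 1 ->
  (forall i, 0 <= a i) -> (forall i, a i * h <= / 2) -> (forall i, 0 <= b i <= 1) ->
  ex_series a -> ex_series b ->
  exists K, (forall n, geo_bound K (/ (1 + h)) (Ecoef g a b n)) /\
    forall n, geo_bound (3 * K * (a n + b n)) (/ (1 + h))
      (fun k => Ecoef g a b (S n) k - Ecoef g a b n k).
Proof.
  intros Hg Hh Ha Hah Hb Hsa Hsb.
  set (r := / (1 + h)). assert (Hr : 0 < r) by (apply Rinv_0_lt_compat; lra).
  set (t := fun i => b i + 2 * a i).
  assert (Ht : ex_series t).
  { apply (ex_series_plus (V := R_NormedModule)); [exact Hsb|].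
    now apply (ex_series_scal_l 2 a). }
  set (T := fun n => Series (fun i => t (n + i)%nat)).
  assert (HT : forall n, 0 <= T n).
  { intros n. apply Series_nonneg; [|now apply ex_series_tail].
    intros i. unfold t. pose proof (Ha (n + i)%nat). pose proof (Hb (n + i)%nat). lra. }
  set (K := exp (- g) * exp (g / r) * exp (T 0%nat)).
  assert (HK : 0 < K).
  { unfold K. repeat apply Rmult_lt_0_compat; apply exp_pos. }
  assert (Hlin : forall n C, geo_bound C r (Ecoef g a b n) ->
    geo_bound (C * (1 + b n)) r (lin (1 - b n) (b n) (Ecoef g a b n))).
  { intros n C HC. pose proof (geo_bound_pos _ _ _ HC).
    apply geo_bound_le with (3 := geo_bound_lin _ _ _ _ _ Hr HC); [exact Hr|].
    (* With [0 <= b n <= 1] the constant of [geo_bound_lin] is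
       [1 - b n + b n * (1 + h) = 1 + b n * h]. *)
    specialize (Hb n). rewrite !Rabs_pos_eq by lra. unfold r, Rdiv. rewrite Rinv_inv.
    rewrite Rmult_comm. apply Rmult_le_compat_l; [assumption|]. nra. }
  assert (HKT : forall n, K * exp (- T n) <= K).
  { intros n. rewrite <- (Rmult_1_r K) at 2. apply Rmult_le_compat_l; [lra|].
    rewrite <- exp_0. destruct (HT n) as [H|H].
    - left. apply exp_increasing. lra.
    - rewrite <- H, Ropp_0. lra. }
  (* The tail [T n] is held in reserve for the remaining steps: [(1 + b n) * (1 + 2 * a n)] is at
     most [exp (b n + 2 * a n) = exp (T n - T (S n))]. *)
  assert (HM : forall n, geo_bound (K * exp (- T n)) r (Ecoef g a b n)).
  { induction n as [|n IH].
    - apply geo_bound_le with (3 := geo_bound_expX1 g r Hg Hr); [exact Hr|].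
      apply Req_le. unfold K. rewrite (Rmult_assoc _ (exp (T 0%nat))).
      rewrite <- (exp_plus (T 0%nat)), Rplus_opp_r, exp_0. ring.
    - simpl Ecoef. apply Hlin in IH.
      apply geo_bound_divlin with (a := a n) in IH; try assumption; auto.
      apply geo_bound_le with (3 := IH); [exact Hr|].
      replace (- T (S n)) with (- T n + (b n + 2 * a n)).
      + rewrite !Rmult_assoc, exp_plus, exp_plus.
        pose proof (exp_ineq1_le (b n)). pose proof (exp_ineq1_le (2 * a n)).
        specialize (Ha n). specialize (Hb n).
        apply Rmult_le_compat_l; [lra|].
        apply Rmult_le_compat_l; [left; apply exp_pos|].
        apply Rmult_le_compat; lra.
      + assert (HS : T n = b n + 2 * a n + T (S n)) by exact (Series_tail_S t n Ht).
        lra. }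
  assert (HMK : forall n, geo_bound K r (Ecoef g a b n)).
  { intros n. now apply geo_bound_le with (3 := HM n). }
  exists K. split; [exact HMK|]. intros n.
  (* Clearing the denominator writes the increment as [a n * (x - 1)] times the new function plus
     [b n * (x - 1)] times the old one. The constant [3] bounds [1 + (1 + h)]. *)
  assert (Hdiff : forall c u, 0 <= c -> geo_bound K r u ->
    geo_bound (3 * K * c) r (lin (- c) c u)).
  { intros c u Hc Hu.
    apply geo_bound_le with (3 := geo_bound_lin _ _ _ _ _ Hr Hu); [exact Hr|].
    rewrite Rabs_Ropp, Rabs_pos_eq by lra. unfold r, Rdiv. rewrite Rinv_inv.
    assert (0 <= K * c) by (apply Rmult_le_pos; lra). nra. }
  pose proof (Hdiff (a n) (Ecoef g a b (S n)) (Ha n) (HMK (S n))) as H1.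
  pose proof (Hdiff (b n) (Ecoef g a b n) (proj1 (Hb n)) (HMK n)) as H2.
  rewrite Rmult_plus_distr_l. intros k.
  replace (Ecoef g a b (S n) k - Ecoef g a b n k) with
    (lin (- a n) (a n) (Ecoef g a b (S n)) k + lin (- b n) (b n) (Ecoef g a b n) k).
  - exact (geo_bound_plus _ _ _ _ _ H1 H2 k).
  - pose proof (lin_divlin (a n) (lin (1 - b n) (b n) (Ecoef g a b n)) k (Ha n)) as HL.
    change (divlin (a n) (lin (1 - b n) (b n) (Ecoef g a b n)))
      with (Ecoef g a b (S n)) in HL.
    unfold lin in *. lra.
Qed.

Lemma PSeries_Ecoef (g h K x : R) (a b : nat -> R) (n : nat) :
  0 < h -> (forall i, 0 <= a i) -> (forall i, a i * h <= / 2) ->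
  (forall n, geo_bound K (/ (1 + h)) (Ecoef g a b n)) ->
  Rabs x < 1 + h ->
  PSeries (Ecoef g a b (S n)) x =
  PSeries (Ecoef g a b n) x * ((1 - b n * (1 - x)) / (1 + a n * (1 - x))).
Proof.
  intros Hh Ha Hah HK Hx.
  assert (Hr : 0 < / (1 + h)) by (apply Rinv_0_lt_compat; lra).
  assert (Hex : forall m, ex_pseries (Ecoef g a b m) x).
  { intros m. apply (geo_bound_pseries K (/ (1 + h)) x); [exact Hr| |apply HK].
    apply Rmult_lt_reg_l with (1 + h); [lra|].
    rewrite <- Rmult_assoc, Rinv_r by lra. lra. }
  assert (Hpos : 0 < 1 + a n * (1 - x)).
  { specialize (Ha n). specialize (Hah n). apply Rabs_def2 in Hx.
    assert (a n * (- h) <= a n * (1 - x)) by (apply Rmult_le_compat_l; lra). lra. }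
  pose proof (PSeries_ext _ _ x (fun k => lin_divlin (a n)
    (lin (1 - b n) (b n) (Ecoef g a b n)) k (Ha n))) as H1.
  rewrite (PSeries_lin _ _ x _ (Hex (S n))), (PSeries_lin _ _ x _ (Hex n)) in H1.
  apply Rmult_eq_reg_l with (1 + a n * (1 - x)); [|lra].
  transitivity ((1 - b n + b n * x) * PSeries (Ecoef g a b n) x).
  - rewrite <- H1. ring.
  - field. lra.
Qed.

Lemma Eom_power_series (alpha beta : nat -> R) (delta : R) :
  in_Omega alpha beta delta -> beta 0%nat < 1 ->
  exists (e : nat -> R) (rho : R), geometric e /\ 1 < rho /\
    forall x, Rabs x < rho -> Eom alpha beta delta x = PSeries e x.
Proof.
  intros (Ha0 & Hadec & Hb0 & Hbdec & Hsum & Hdelta) Hb1.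
  assert (Hamax : forall i, alpha i <= alpha 0%nat).
  { induction i as [|i IH]; [lra|]. specialize (Hadec i). lra. }
  assert (Hbmax : forall i, beta i <= beta 0%nat).
  { induction i as [|i IH]; [lra|]. specialize (Hbdec i). lra. }
  set (A := 1 + alpha 0%nat).
  assert (HA : 1 <= A) by (unfold A; specialize (Ha0 0%nat); lra).
  set (a := fun i => alpha i + alpha i ^ 2 / 2).
  set (b := fun i => beta i - beta i ^ 2 / 2).
  assert (Ha : forall i, 0 <= a i <= A * alpha i).
  { intros i. unfold a, A. specialize (Ha0 i). specialize (Hamax i). nra. }
  assert (Hb : forall i, 0 <= b i <= 1 /\ b i <= beta i).
  { intros i. unfold b. specialize (Hb0 i). specialize (Hbmax i). nra. }
  assert (Hsa : ex_series a).
  { apply (@ex_series_le R_AbsRing R_CompleteNormedModule) with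
      (fun i => A * (alpha i + beta i)).
    - intros i. change (Rabs (a i) <= A * (alpha i + beta i)).
      specialize (Ha i). specialize (Hb0 i). rewrite Rabs_pos_eq by lra. nra.
    - now apply (ex_series_scal_l A (fun i => alpha i + beta i)). }
  assert (Hsb : ex_series b).
  { apply (@ex_series_le R_AbsRing R_CompleteNormedModule) with
      (fun i => alpha i + beta i); [|exact Hsum].
    intros i. change (Rabs (b i) <= alpha i + beta i).
    specialize (Hb i). specialize (Ha0 i). rewrite Rabs_pos_eq; lra. }
  set (g := gammaO alpha beta delta).
  assert (Hg : 0 <= g) by (unfold g, gammaO; lra).
  (* Each [a i] is at most [A * alpha i <= A * A], so this [h] gives [a i * h <= / 2] for all
     factors at once. *)
  set (h := / (2 * (A * A))).
  assert (HAA : 1 <= A * A) by nra.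
  assert (Hh : 0 < h <= 1).
  { unfold h. split; [apply Rinv_0_lt_compat; lra|].
    apply Rle_trans with (/ 1); [apply Rinv_le_contravar; lra|lra]. }
  assert (Hah : forall i, a i * h <= / 2).
  { intros i. replace (/ 2) with (A * A * h) by (unfold h; field; lra).
    apply Rmult_le_compat_r; [lra|]. destruct (Ha i) as [_ H].
    eapply Rle_trans; [exact H|]. apply Rmult_le_compat_l; [lra|].
    unfold A. specialize (Hamax i). lra. }
  destruct (Ecoef_bounds g h a b Hg Hh (fun i => proj1 (Ha i)) Hah
    (fun i => proj1 (Hb i)) Hsa Hsb) as (K & HK & HD).
  assert (Hr : 0 < / (1 + h)) by (apply Rinv_0_lt_compat; lra).
  destruct (geo_bound_limit (Ecoef g a b) (fun n => 3 * K * (a n + b n)) K (/ (1 + h)) Hr)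
    as (e & C & He & Hlim); [|exact HK|exact HD|].
  { apply (ex_series_scal_l (3 * K) (fun n => a n + b n)).
    now apply (ex_series_plus (V := R_NormedModule)). }
  exists e, (1 + h). split; [|split; [lra|]].
  - exists C, (/ (1 + h)). split; [|exact He]. split; [exact Hr|].
    rewrite <- Rinv_1. apply Rinv_lt_contravar; lra.
  - intros x Hx.
    assert (Hpart : forall n, PSeries (Ecoef g a b n) x
      = exp (g * (x - 1)) * Epartial alpha beta n x).
    { induction n as [|n IH].
      - simpl. rewrite PSeries_expX1. ring.
      - rewrite (PSeries_Ecoef g h K x a b n) by (auto; lra || (intros; apply Ha)).
        rewrite IH. simpl Epartial. unfold Efactor.
        replace (1 - b n * (1 - x)) with
          (1 - beta n * (1 - x) + (beta n)^2 * (1 - x) / 2) by (unfold b; field).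
        replace (1 + a n * (1 - x)) with
          (1 + alpha n * (1 - x) + (alpha n)^2 * (1 - x) / 2) by (unfold a; field).
        ring. }
    unfold Eom. fold g. pose proof (exp_pos (g * (x - 1))) as Hexp.
    (* [Ecoef] includes the exponential from the start, so it is divided out; the limit is thereby a
       finite number, which [real] returns unchanged. *)
    rewrite (is_lim_seq_unique _ (PSeries e x / exp (g * (x - 1)))).
    + simpl. field. lra.
    + apply is_lim_seq_ext with (fun n => PSeries (Ecoef g a b n) x * / exp (g * (x - 1))).
      * intros n. rewrite Hpart. field. lra.
      * apply (is_lim_seq_scal_r _ _ (PSeries e x)). apply Hlim.
        apply Rmult_lt_reg_l with (1 + h); [lra|].
        rewrite <- Rmult_assoc, Rinv_r by lra. lra.
Qed.

(** * The level functions *)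

Lemma PsiIs_Psi (alpha beta : nat -> R) (delta : R) (N : nat) (a : bool)
    (n : nat) (b : bool) (l s : nat) (u : nat -> R) :
  geometric u -> 2 * INR n + hv b <= 2 * INR N + hv a ->
  (forall z, PsiTop alpha beta delta N a l z = Psi a u z) ->
  PsiIs alpha beta delta N a n b l s (Psi b (Nat.iter (N - n) divX1 u) s).
Proof.
  intros Hu Hle Htop. unfold PsiIs.
  destruct (Nat.eqb_spec n N) as [En|En], (Bool.eqb_spec b a) as [Eb|Eb]; simpl.
  1: { subst. rewrite Nat.sub_diag. apply Htop. }
  all: apply is_series_ext with (fun z => Psi a u z * phiL n b N a z s);
    [intros z; now rewrite Htop|].
  all: apply transforms_phiL; [exact Hu|].
  (* Distinct levels never tie: if only one component differs this is immediate, and if both differ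
     a tie would make an even number odd. *)
  all: destruct Hle as [Hlt|Heq]; [exact Hlt|exfalso].
  - subst. destruct a, b; simpl in *; (congruence || lra).
  - subst. apply En, INR_eq. lra.
  - destruct a, b; simpl in *; try congruence.
    + enough (2 * n = S (2 * N))%nat by lia.
      apply INR_eq. rewrite S_INR, !mult_INR. simpl. lra.
    + enough (2 * N = S (2 * n))%nat by lia.
      apply INR_eq. rewrite S_INR, !mult_INR. simpl. lra.
Qed.

Theorem theorem4p4 (alpha beta : nat -> R) (delta : R) (N : nat) (a : bool)
  (n1 : nat) (a1 : bool) :
  in_Omega alpha beta delta -> beta 0%nat < 1 ->
  (1 <= N)%nat -> (1 <= n1)%nat ->
  2 * INR n1 + hv a1 <= 2 * INR N + hv a ->
  (forall (l s : nat), (1 <= l <= n1)%nat ->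
     exists I : R,
       is_RInt_gen (fun x => Eom alpha beta delta x * Jac a1 s x * (x - 1) ^ (n1 - l) *
                             Rpower (1 - x) (hv a1) * Rpower (1 + x) (-1/2))
                   (at_right (-1)) (at_left 1) I /\
       PsiIs alpha beta delta N a n1 a1 l s (Wt a1 s / PI * I)) /\
  (forall (l s : nat), (n1 < l <= N)%nat ->
     exists I : R,
       is_RInt_gen (fun x =>
           (Eom alpha beta delta x -
            sum_f_R0 (fun j => Derive_n (Eom alpha beta delta) j 1 / INR (fact j) * (x - 1) ^ j)
                     (l - n1 - 1)) / (x - 1) ^ (l - n1) *
           Jac a1 s x * Rpower (1 - x) (hv a1) * Rpower (1 + x) (-1/2))
                   (at_right (-1)) (at_left 1) I /\
       PsiIs alpha beta delta N a n1 a1 l s (Wt a1 s / PI * I)).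
Proof.
  intros HO Hb _ _ Hle.
  destruct (Eom_power_series alpha beta delta HO Hb) as (e & rho & He & Hrho & HE).
  assert (HE1 : forall x, -1 < x < 1 -> Eom alpha beta delta x = PSeries e x).
  { intros x Hx. apply HE. apply Rabs_def1; lra. }
  assert (Htop : forall l z, PsiTop alpha beta delta N a l z
                             = Psi a (Nat.iter (N - l) mulX1 e) z).
  { intros l z.
    edestruct (is_RInt_gen_Psi a (Nat.iter (N - l) mulX1 e) z) as (I & HI & HPsi);
      [now apply geometric_iter_mulX1| |].
    2:{ unfold PsiTop. rewrite <- HPsi. f_equal. apply is_RInt_gen_unique. exact HI. }
    intros x Hx. cbv beta. rewrite HE1 by exact Hx.
    rewrite PSeries_iter_mulX1; [ring|exact He|apply Rabs_le; lra]. }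
  assert (HPsiIs : forall l s, PsiIs alpha beta delta N a n1 a1 l s
    (Psi a1 (Nat.iter (N - n1) divX1 (Nat.iter (N - l) mulX1 e)) s)).
  { intros l s. apply PsiIs_Psi; [now apply geometric_iter_mulX1|exact Hle|].
    intros z. apply Htop. }
  assert (Hn : (n1 <= N)%nat).
  { enough (n1 < S N)%nat by lia. apply INR_lt. rewrite S_INR.
    destruct a, a1; simpl in Hle; lra. }
  split; intros l s Hl.
  - assert (Hs : Nat.iter (N - n1) divX1 (Nat.iter (N - l) mulX1 e)
                 = Nat.iter (n1 - l) mulX1 e).
    { replace (N - l)%nat with (N - n1 + (n1 - l))%nat by lia.
      rewrite Nat.iter_add. now apply iter_divX1_mulX1, geometric_iter_mulX1. }
    edestruct (is_RInt_gen_Psi a1 (Nat.iter (n1 - l) mulX1 e) s) as (I & HI & HPsi);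
      [now apply geometric_iter_mulX1| |exists I; split; [exact HI|]].
    + intros x Hx. cbv beta. rewrite HE1 by exact Hx.
      rewrite PSeries_iter_mulX1; [ring|exact He|apply Rabs_le; lra].
    + rewrite HPsi, <- Hs. apply HPsiIs.
  - assert (Hs : Nat.iter (N - n1) divX1 (Nat.iter (N - l) mulX1 e)
                 = Nat.iter (l - n1) divX1 e).
    { replace (N - n1)%nat with (l - n1 + (N - l))%nat by lia.
      rewrite Nat.iter_add. now rewrite iter_divX1_mulX1. }
    (* The derivatives at [1] are two-sided, so the equality with the power series is taken from
       [HE], which reaches beyond [1], and not from [HE1]. *)
    assert (HT : forall j, Derive_n (Eom alpha beta delta) j 1 / INR (fact j)
                           = PSeries (Nat.iter j divX1 e) 1).
    { intros j. rewrite <- Derive_n_PSeries_at_1 by exact He. f_equal.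
      apply Derive_n_ext_loc.
      assert (H1 : Rabs 1 < rho) by (rewrite Rabs_R1; exact Hrho).
      apply filter_imp with (2 := locally_Rabs_lt _ _ H1). exact HE. }
    edestruct (is_RInt_gen_Psi a1 (Nat.iter (l - n1) divX1 e) s) as (I & HI & HPsi);
      [now apply geometric_iter_divX1| |exists I; split; [exact HI|]].
    + intros x Hx. cbv beta. do 3 f_equal. rewrite HE1 by exact Hx.
      assert (Hk : (l - n1 = S (l - n1 - 1))%nat) by lia.
      rewrite (PSeries_iter_divX1 (l - n1 - 1) e x He) by (apply Rabs_le; lra).
      rewrite <- Hk, (sum_eq _ _ _ (fun j _ => f_equal (fun c => c * (x - 1) ^ j) (HT j))).
      field. apply pow_nonzero. lra.
    + rewrite HPsi, <- Hs. apply HPsiIs.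
Qed.
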